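(* Let $f:[0,1]\times\mathbb{R}^n\times U\times V\to\mathbb{R}^n$ satisfy the standing assumptions given in the context (boundedness, Lipschitz continuity in $(t,x)$, existence of the value in all local games), and let $g:\mathbb{R}^n\to\mathbb{R}$ be Lipschitz continuous. Let $(t_0,x_0)\in[0,1]\times\mathbb{R}^n$. Then the differential game $\mathcal{G}(t_0,x_0)$ has a value, i.e. $V^-(t_0,x_0)=V^+(t_0,x_0)=:\mathbf{V}(t_0,x_0)$, and it is characterized by $$\mathbf{V}(t_0,x_0)=\inf_{\phi}\ \phi(t_0,x_0),$$ where the infimum is over all functions $\phi:[t_0,1]\times\mathbb{R}^n\to\mathbb{R}$ satisfying: (i) $x\mapsto\phi(t,x)$ is lower semicontinuous for all $t\in[t_0,1]$; (ii) for all $(t,x)\in[t_0,1]\times\mathbb{R}^n$ and $t'\in[t,1]$, $\ \phi(t,x)\ge\sup_{u\in U}\inf_{\mathbf{v}\in\mathcal{V}}\phi\big(t',\mathbf{x}[t,x,u,\mathbf{v}](t')\big)$; (iii) $\phi(1,x)\ge g(x)$ for all $x\in\mathbb{R}^n$. Moreover, the extremal strategies $\beta(\mathbf{V},\Pi,\pi)$ associated with the value function $\mathbf{V}:[t_0,1]\times\mathbb{R}^n\to\mathbb{R}$ are asymptotically optimal for player 2 in $\mathcal{G}(t_0,x_0)$ as $\|\Pi\|\to0$: for every $\varepsilon>0$ there is $\delta>0$ such that for every partition $\Pi$ of $[t_0,1]$ with $\|\Pi\|\le\delta$ and every associated selection $\pi$, the strategy $\beta=\beta(\mathbf{V},\Pi,\pi)$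 satisfies $$\sup_{\alpha\in\mathcal{A}}g\big(\mathbf{x}[t_0,x_0,\alpha,\beta](1)\big)\le\mathbf{V}(t_0,x_0)+\varepsilon .$$
   Context: **Setting.** $U$ and $V$ are nonempty compact subsets of Euclidean spaces, $\|\cdot\|$ and $\langle\cdot,\cdot\rangle$ are the Euclidean norm and inner product on $\mathbb{R}^n$, and $f:[0,1]\times\mathbb{R}^n\times U\times V\to\mathbb{R}^n$. **Standing assumptions on $f$.** - $\|f\|:=\sup_{(t,x,u,v)}\|f(t,x,u,v)\|<+\infty$. - There is $c\ge0$ with $\|f(t,x,u,v)-f(s,y,u,v)\|\le c(|t-s|+\|x-y\|)$ for all $(u,v)\in U\times V$, $s,t\in[0,1]$, $x,y\in\mathbb{R}^n$. - For every $(t,x,\xi)\in[0,1]\times\mathbb{R}^n\times\mathbb{R}^n$, the local game $\Gamma(t,x,\xi)$ has a value (Isaacs' condition). Here $\Gamma(t,x,\xi)$ is the one-shot zero-sum game with action sets $U$ (maximizer, player 1) and $V$ (minimizer, player 2) and payoff $(u,v)\mapsto\langle\xi,f(t,x,u,v)\rangle$. Having a value means $\max_{u\in U}\min_{v\in V}\langle\xi,f(t,x,u,v)\rangle=\min_{v\in V}\max_{u\in U}\langle\xi,f(t,x,u,v)\rangle$. An action $v^*\in V$ is optimal in $\Gamma(t,x,\xi)$ if it attains the outer minimum on the right. - (Implicit well-posedness.) The maxima and minima above are attained, and for all measurable $\mathbf{u}:[0,1]\to U$, $\mathbf{v}:[0,1]\to V$ and all $x$, the map $t\mapsto f(t,x,\mathbf{u}(t),\mathbf{v}(t))$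 is measurable. **Controls and trajectories.** $\mathcal{U}$ and $\mathcal{V}$ are the sets of measurable maps $[0,1]\to U$ and $[0,1]\to V$. Elements of $U$, $V$ are identified with constant controls. For $(t,x,\mathbf{u},\mathbf{v})\in[0,1]\times\mathbb{R}^n\times\mathcal{U}\times\mathcal{V}$, $\mathbf{x}[t,x,\mathbf{u},\mathbf{v}]$ is the absolutely continuous solution on $[t,1]$ of $\dot{\mathbf{x}}(s)=f(s,\mathbf{x}(s),\mathbf{u}(s),\mathbf{v}(s))$ a.e., $\mathbf{x}(t)=x$. **Strategies.** In the game with initial time $t_0$, a strategy for player 2 is a map $\beta:\mathcal{U}\to\mathcal{V}$ such that, for some finite partition $t_0=s_0<s_1<\dots<s_N=1$ of $[t_0,1]$, for all $\mathbf{u}_1,\mathbf{u}_2\in\mathcal{U}$ and $0\le m<N$: if $\mathbf{u}_1=\mathbf{u}_2$ a.e. on $[s_0,s_m]$ then $\beta(\mathbf{u}_1)=\beta(\mathbf{u}_2)$ a.e. on $[s_0,s_{m+1}]$. Strategies $\alpha:\mathcal{V}\to\mathcal{U}$ of player 1 are defined dually. $\mathcal{A}$ and $\mathcal{B}$ are the sets of strategies of players 1 and 2. For each $(\alpha,\beta)\in\mathcal{A}\times\mathcal{B}$ there is a pair $(\bar{\mathbf{u}},\bar{\mathbf{v}})\in\mathcal{U}\times\mathcal{V}$, unique up to a.e. equality on $[t_0,1]$, with $\alpha(\bar{\mathbf{v}})=\bar{\mathbf{u}}$ and $\beta(\bar{\mathbf{u}})=\bar{\mathbf{v}}$ on $[t_0,1]$;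 set $\mathbf{x}[t_0,x_0,\alpha,\beta]:=\mathbf{x}[t_0,x_0,\bar{\mathbf{u}},\bar{\mathbf{v}}]$. **The game.** $\mathcal{G}(t_0,x_0)$ is the zero-sum differential game on $[t_0,1]$ with terminal payoff $g$ (maximized by player 1, minimized by player 2). Its lower and upper values are $$V^-(t_0,x_0)=\sup_{\alpha\in\mathcal{A}}\inf_{\beta\in\mathcal{B}}g(\mathbf{x}[t_0,x_0,\alpha,\beta](1)),\qquad V^+(t_0,x_0)=\inf_{\beta\in\mathcal{B}}\sup_{\alpha\in\mathcal{A}}g(\mathbf{x}[t_0,x_0,\alpha,\beta](1)),$$ with $V^\pm(1,x)=g(x)$. The value function is $\mathbf{V}=V^-=V^+$ at every $(t,x)$. **Extremal strategies.** Let $t_0<1$, let $\phi:[t_0,1]\times\mathbb{R}^n\to\mathbb{R}$ satisfy (i), (ii), (iii), and let $\Pi=\{t_0<t_1<\dots<t_N=1\}$ be a partition of $[t_0,1]$, with $\|\Pi\|:=\max_{1\le m\le N}(t_m-t_{m-1})$. Let $\mathcal{W}^\phi(t):=\{x\in\mathbb{R}^n:\phi(t,x)\le\phi(t_0,x_0)\}$ for $t\in[t_0,1]$ (these sets are closed and nonempty). Let $\pi_1$ be a selection rule assigning to each $(t,x)\in[t_0,1]\times\mathbb{R}^n$ a closest point to $x$ in $\mathcal{W}^\phi(t)$, let $\pi_2$ be a selection rule assigning to each $(t,x,\xi)$ an action $\pi_2(t,x,\xi)\in V$ optimal in $\Gamma(t,x,\xi)$, and put $\pi(t,x):=\pi_2(t,x,x-\pi_1(t,x))$.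 The extremal strategy $\beta=\beta(\phi,\Pi,\pi):\mathcal{U}\to\mathcal{V}$ is defined inductively: if $\beta(\mathbf{u})$ is already defined on $[t_0,t_m]$, $0\le m<N$, let $x_m=\mathbf{x}[t_0,x_0,\mathbf{u},\beta(\mathbf{u})](t_m)$ and set $\beta(\mathbf{u})\equiv\pi(t_m,x_m)$ on $[t_m,t_{m+1}]$ (values at the finitely many grid points and before $t_0$ are irrelevant). *)

(* Defs.v *)
From HB Require Import structures.
From mathcomp Require Import all_boot all_order all_algebra.
From mathcomp Require Import all_classical all_reals all_analysis.
From mathcomp Require Import measurable_realfun.

Set Implicit Arguments.
Unset Strict Implicit.
Unset Printing Implicit Defensive.

Import Order.TTheory GRing.Theory Num.Theory.
Import numFieldNormedType.Exports.

Local Open Scope classical_set_scope.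
Local Open Scope ring_scope.

(* Time-dependent objects are total functions on R, constrained only on the   *)
(* relevant interval. The library norm on 'rV[R]_m is the sup norm, hence the *)
(* explicit Euclidean norm; both norms induce the topology of 'rV[R]_m.       *)

Section Euclidean.
Context {R : realType} {m : nat}.
Implicit Types x y : 'rV[R]_m.

Definition dotp x y : R := \sum_(i < m) x 0 i * y 0 i.

Definition enorm x : R := Num.sqrt (dotp x x).

End Euclidean.

(* R with the sigma-algebra of Lebesgue measurable sets, i.e., the completion *)
(* of the Borel sigma-algebra for the Lebesgue measure                        *)
Definition lebesgueType (R : realType) :=
  g_sigma_algebraType (completed_algebra_gen (@lebesgue_measure R)).

Definition borelType (R : realType) (m : nat) :=
  g_sigma_algebraType (@open 'rV[R]_m).

Section Trajectories.
Context {R : realType}.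

Definition measurable01 (m : nat) (h : R -> 'rV[R]_m) : Prop :=
  measurable_fun (`[0, 1]%classic : set (lebesgueType R))
    (h : lebesgueType R -> borelType R m).

Definition controls (m : nat) (U : set 'rV[R]_m) : set (R -> 'rV[R]_m) :=
  [set u | (forall t, 0 <= t <= 1 -> U (u t)) /\ measurable01 u].

Definition eq_ae_on (m : nat) (a b : R) (u1 u2 : R -> 'rV[R]_m) : Prop :=
  u1 = u2 %[ae (@lebesgue_measure R) in `[a, b]%classic].

Definition absolutely_continuous_on (m : nat) (a b : R) (X : R -> 'rV[R]_m) :
    Prop :=
  forall e : R, 0 < e -> exists2 d : R, 0 < d &
    forall (N : nat) (p q : 'I_N -> R),
      (forall i, [/\ a <= p i, p i <= q i & q i <= b]) ->
      trivIset [set: 'I_N] (fun i => `]p i, q i[%classic) ->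
      \sum_(i < N) (q i - p i) < d ->
      \sum_(i < N) enorm (X (q i) - X (p i)) < e.

Context {n k l : nat}.
Variable f : R -> 'rV[R]_n -> 'rV[R]_k -> 'rV[R]_l -> 'rV[R]_n.

Definition is_trajectory (t : R) (x : 'rV[R]_n) (u : R -> 'rV[R]_k)
    (v : R -> 'rV[R]_l) : set (R -> 'rV[R]_n) :=
  [set X | [/\ absolutely_continuous_on t 1 X, X t = x &
    {ae @lebesgue_measure R, forall s, t < s < 1 ->
      is_derive s 1 X (f s (X s) (u s) (v s))}]].

(* the solution is unique on [t, 1]; the choice elsewhere is irrelevant *)
Definition trajectory t x u v : R -> 'rV[R]_n := get (is_trajectory t x u v).

End Trajectories.

Section OneShotGame.
Context {R : realType} {S T : Type}.
Variables (U : set S) (V : set T) (p : S -> T -> R).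
Local Open Scope ereal_scope.

Definition min_payoff (u : S) : \bar R := ereal_inf [set (p u v)%:E | v in V].

Definition max_payoff (v : T) : \bar R := ereal_sup [set (p u v)%:E | u in U].

Record has_value : Prop := HasValue {
  min_attained : forall u, U u -> exists2 v, V v & (p u v)%:E = min_payoff u ;
  max_attained : forall v, V v -> exists2 u, U u & (p u v)%:E = max_payoff v ;
  maxmin_attained : exists2 u, U u & min_payoff u = ereal_sup (min_payoff @` U) ;
  minmax_attained : exists2 v, V v & max_payoff v = ereal_inf (max_payoff @` V) ;
  maxmin_eq_minmax :
    ereal_sup (min_payoff @` U) = ereal_inf (max_payoff @` V) }.

Definition optimal_min (v : T) : Prop :=
  V v /\ max_payoff v = ereal_inf (max_payoff @` V).

End OneShotGame.

Section Game.
Context {R : realType} {n k l : nat}.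
Variables (U : set 'rV[R]_k) (V : set 'rV[R]_l).
Variable f : R -> 'rV[R]_n -> 'rV[R]_k -> 'rV[R]_l -> 'rV[R]_n.
Variable g : 'rV[R]_n -> R.

Definition local_payoff (t : R) (x xi : 'rV[R]_n) (u : 'rV[R]_k)
    (v : 'rV[R]_l) : R := dotp xi (f t x u v).

Record standing_assumptions : Prop := StandingAssumptions {
  f_bounded : exists M : R, forall t x u v,
    0 <= t <= 1 -> U u -> V v -> enorm (f t x u v) <= M ;
  f_lipschitz : exists2 c : R, 0 <= c & forall t s x y u v,
    0 <= t <= 1 -> 0 <= s <= 1 -> U u -> V v ->
    enorm (f t x u v - f s y u v) <= c * (`|t - s| + enorm (x - y)) ;
  f_isaacs : forall t x xi, 0 <= t <= 1 -> has_value U V (local_payoff t x xi) ;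
  f_measurable : forall u v x, controls U u -> controls V v ->
    measurable01 (fun t => f t x (u t) (v t)) }.

(* [grid a s m] is the point s_m of the partition a = s_0 < s_1 < ... < s_N,  *)
(* where s = [:: s_1; ...; s_N]                                               *)
Definition grid (a : R) (s : seq R) (m : nat) : R := nth a (a :: s) m.

Definition mesh (a : R) (s : seq R) : R :=
  \big[Num.max/0]_(m < size s) (grid a s m.+1 - grid a s m).

(* Strategies against controls with values in [A], with responses in [B];     *)
(* outside [controls A] the map is irrelevant.                                *)
Definition strategies (i j : nat) (A : set 'rV[R]_i) (B : set 'rV[R]_j)
    (t0 : R) : set ((R -> 'rV[R]_i) -> (R -> 'rV[R]_j)) :=
  [set b | (forall u, controls A u -> controls B (b u)) /\
    exists2 s : seq R, itv_partition t0 1 s &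
      forall u1 u2 m, controls A u1 -> controls A u2 -> (m < size s)%N ->
        eq_ae_on t0 (grid t0 s m) u1 u2 ->
        eq_ae_on t0 (grid t0 s m.+1) (b u1) (b u2)].

Definition strategies1 (t0 : R) := strategies V U t0.
Definition strategies2 (t0 : R) := strategies U V t0.

(* the pair of controls generated by a pair of strategies, unique up to a.e.  *)
(* equality on [t0, 1]                                                        *)
Definition play (t0 : R) (a : (R -> 'rV[R]_l) -> (R -> 'rV[R]_k))
    (b : (R -> 'rV[R]_k) -> (R -> 'rV[R]_l)) :
    (R -> 'rV[R]_k) * (R -> 'rV[R]_l) :=
  get [set w | [/\ controls U w.1, controls V w.2,
                   eq_ae_on t0 1 (a w.2) w.1 & eq_ae_on t0 1 (b w.1) w.2]].

Definition outcome (t0 : R) (x0 : 'rV[R]_n) a b : R :=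
  g (trajectory f t0 x0 (play t0 a b).1 (play t0 a b).2 1).

(* For t0 = 1 all the outcomes are g x0, hence so are both values.            *)
Definition lower_value (t0 : R) (x0 : 'rV[R]_n) : \bar R :=
  ereal_sup [set ereal_inf [set (outcome t0 x0 a b)%:E | b in strategies2 t0]
            | a in strategies1 t0].

Definition upper_value (t0 : R) (x0 : 'rV[R]_n) : \bar R :=
  ereal_inf [set ereal_sup [set (outcome t0 x0 a b)%:E | a in strategies1 t0]
            | b in strategies2 t0].

Definition value (t0 : R) (x0 : 'rV[R]_n) : R := fine (lower_value t0 x0).

Record value_majorant (t0 : R) (phi : R -> 'rV[R]_n -> R) : Prop :=
  ValueMajorant {
    majorant_lsc : forall t, t0 <= t <= 1 ->
      lower_semicontinuous (fun x => (phi t x)%:E) ;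
    majorant_dpp : forall t x t', t0 <= t <= 1 -> t <= t' <= 1 ->
      (ereal_sup [set ereal_inf
          [set (phi t' (trajectory f t x (cst u) v t'))%:E | v in controls V]
        | u in U] <= (phi t x)%:E)%E ;
    majorant_terminal : forall x, g x <= phi 1 x }.

Definition sublevel (phi : R -> 'rV[R]_n -> R) (t0 : R) (x0 : 'rV[R]_n)
    (t : R) : set 'rV[R]_n := [set x | phi t x <= phi t0 x0].

Definition closest_selection (phi : R -> 'rV[R]_n -> R) (t0 : R)
    (x0 : 'rV[R]_n) (pi1 : R -> 'rV[R]_n -> 'rV[R]_n) : Prop :=
  forall t x, t0 <= t <= 1 -> sublevel phi t0 x0 t (pi1 t x) /\
    forall y, sublevel phi t0 x0 t y -> enorm (x - pi1 t x) <= enorm (x - y).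

Definition optimal_selection (t0 : R)
    (pi2 : R -> 'rV[R]_n -> 'rV[R]_n -> 'rV[R]_l) : Prop :=
  forall t x xi, t0 <= t <= 1 ->
    optimal_min U V (local_payoff t x xi) (pi2 t x xi).

Section Extremal.
Variables (t0 : R) (x0 : 'rV[R]_n) (s : seq R).
Variable pi1 : R -> 'rV[R]_n -> 'rV[R]_n.
Variable pi2 : R -> 'rV[R]_n -> 'rV[R]_n -> 'rV[R]_l.

Definition feedback (t : R) (x : 'rV[R]_n) : 'rV[R]_l :=
  pi2 t x (x - pi1 t x).

(* [extremal_upto u m] is the answer to u constructed on [t0, t_m[; its       *)
(* values from t_m on are not used.                                           *)
Fixpoint extremal_upto (u : R -> 'rV[R]_k) (m : nat) : R -> 'rV[R]_l :=
  if m is m'.+1 then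
    let v := extremal_upto u m' in
    let tm := grid t0 s m' in
    fun r => if r < tm then v r else feedback tm (trajectory f t0 x0 u v tm)
  else cst (feedback t0 x0).

Definition extremal_strategy (u : R -> 'rV[R]_k) : R -> 'rV[R]_l :=
  extremal_upto u (size s).

End Extremal.

End Game.

(* Main.v *)
Require Import Defs.
From mathcomp Require Import all_boot all_order all_algebra finmap.
From mathcomp Require Import all_classical all_reals all_analysis.
From mathcomp Require Import measurable_realfun ring lra.

(** Let phi satisfy the three conditions and let player 2 use the extremal
    strategy for phi.  At a grid point t_m let w be the point of the sublevel
    set of phi closest to the current position x, and let (a, b) be a saddle
    point of the local game in the direction x - w.  Player 2 plays b.  By the
    dynamic programming inequality, the sublevel set contains at time t_(m+1)
    a limit of end points of trajectories issued from w and driven by a and by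
    some controls of player 2.  The saddle inequality says that, whatever
    player 1 does, the two trajectories separate in the direction x - w only through
    the variations of f ([aiming_step]); the squared distance to the sublevel set
    therefore grows from d to at most (1 + C h) d + C h^2 on a step of length
    h, and stays of the order of the mesh ([extremal_distance]).  At time 1
    g is at most phi(t0, x0) on the sublevel set, so the strategy guarantees
    phi(t0, x0) up to an error that vanishes with the mesh.  In particular the upper value is
    at most phi(t0, x0).

    Conversely the lower value satisfies the three conditions
    ([value_is_majorant]).  It is Lipschitz in x, and for the dynamic
    programming inequality player 1 plays a constant action a until t' and
    continues with a nearly optimal strategy for the position reached there.
    A strategy must have one finite partition, hence the nearly optimal
    strategies are taken from a finite net of the reachable set, for which a
    common refinement exists ([strategy_net], [value_superoptimal]).  Applying
    the first part to the lower value gives the existence of the value, its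
    characterization as an infimum, and the asymptotic optimality.

    Two reductions make this precise.  Against a fixed strategy of player 1
    the strategies of player 2 are no better than controls ([inf_outcome]), so
    plays only have to be shown to exist ([play_exists]).  Trajectories are
    compared through their derivatives alone: an absolutely continuous
    function with a.e. nonpositive derivative is nonincreasing
    ([abs_cont_nonincreasing]), which yields Lipschitz and Gronwall bounds,
    uniqueness and the aiming estimate.  Integration only enters through the
    existence of primitives of bounded Lebesgue measurable functions
    ([primitive]), on which the successive approximations of
    [trajectory_exists] are built. *)

Set Implicit Arguments.
Unset Strict Implicit.
Unset Printing Implicit Defensive.

Import Order.TTheory GRing.Theory Num.Theory.
Import numFieldNormedType.Exports.

Local Open Scope classical_set_scope.
Local Open Scope ring_scope.

(** * Euclidean norm *)

Section EuclideanNorm.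
Context {R : realType} {m : nat}.
Implicit Types x y z : 'rV[R]_m.

Lemma dotpC x y : dotp x y = dotp y x.
Proof. by apply: eq_bigr => i _; rewrite mulrC. Qed.

Lemma dotpDl x y z : dotp (x + y) z = dotp x z + dotp y z.
Proof.
by rewrite /dotp -big_split; apply: eq_bigr => i _; rewrite mxE mulrDl.
Qed.

Lemma dotpDr x y z : dotp x (y + z) = dotp x y + dotp x z.
Proof. by rewrite dotpC dotpDl !(dotpC _ x). Qed.

Lemma dotpNl x y : dotp (- x) y = - dotp x y.
Proof. by rewrite /dotp -sumrN; apply: eq_bigr => i _; rewrite mxE mulNr. Qed.

Lemma dotpNr x y : dotp x (- y) = - dotp x y.
Proof. by rewrite dotpC dotpNl dotpC. Qed.

Lemma dotpBl x y z : dotp (x - y) z = dotp x z - dotp y z.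
Proof. by rewrite dotpDl dotpNl. Qed.

Lemma dotpBr x y z : dotp x (y - z) = dotp x y - dotp x z.
Proof. by rewrite dotpDr dotpNr. Qed.

Lemma dotpZl a x y : dotp (a *: x) y = a * dotp x y.
Proof. by rewrite /dotp mulr_sumr; apply: eq_bigr => i _; rewrite mxE mulrA. Qed.

Lemma dotpZr a x y : dotp x (a *: y) = a * dotp x y.
Proof. by rewrite dotpC dotpZl dotpC. Qed.

Lemma dotpxx_ge0 x : 0 <= dotp x x.
Proof. by apply: sumr_ge0 => i _; rewrite -expr2 sqr_ge0. Qed.

Lemma enorm_ge0 x : 0 <= enorm x. Proof. exact: sqrtr_ge0. Qed.

Lemma sqr_enorm x : enorm x ^+ 2 = dotp x x.
Proof. by rewrite sqr_sqrtr ?dotpxx_ge0. Qed.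

Lemma enorm0 : enorm (0 : 'rV[R]_m) = 0.
Proof. by rewrite /enorm /dotp big1 ?sqrtr0// => i _; rewrite mxE mul0r. Qed.

Lemma enormN x : enorm (- x) = enorm x.
Proof. by rewrite /enorm dotpNl dotpNr opprK. Qed.

Lemma enormB x y : enorm (x - y) = enorm (y - x).
Proof. by rewrite -enormN opprB. Qed.

Lemma enorm_coord x i : `|x 0 i| <= enorm x.
Proof.
rewrite -(@ler_pXn2r _ 2) ?nnegrE ?enorm_ge0// sqr_enorm real_normK ?num_real//.
rewrite /dotp (bigD1 i)//= -expr2 lerDl.
by apply: sumr_ge0 => j _; rewrite -expr2 sqr_ge0.
Qed.

Lemma enorm_eq0 x : enorm x = 0 -> x = 0.
Proof.
move=> x0; apply/rowP => i; rewrite mxE.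
by apply/eqP; rewrite -normr_le0 -x0 enorm_coord.
Qed.

Lemma mx_norm_le_enorm x : `|x| <= enorm x.
Proof.
rewrite [leLHS]/Num.norm /= mx_normrE.
apply: bigmax_le => [|[i j] _ /=]; first exact: enorm_ge0.
by rewrite ord1 enorm_coord.
Qed.

(** Expand the squared norm of |y|^2 x - <x, y> y, which is nonnegative. *)
Lemma CauchySchwarz x y : dotp x y <= enorm x * enorm y.
Proof.
have [y0|y0] := eqVneq (enorm y) 0.
  move/enorm_eq0 : y0 => ->; rewrite enorm0 mulr0 /dotp big1// => i _.
  by rewrite mxE mulr0.
have yp : 0 < enorm y by rewrite lt_def y0 enorm_ge0.
have := dotpxx_ge0 (enorm y ^+ 2 *: x - dotp x y *: y).
rewrite dotpBl !dotpBr !dotpZl !dotpZr -!sqr_enorm (dotpC y x) => H.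
have {}H : 0 <= enorm y ^+ 2 * ((enorm x * enorm y) ^+ 2 - dotp x y ^+ 2).
  by apply: (le_trans H); rewrite le_eqVlt; apply/orP; left; apply/eqP; ring.
rewrite pmulr_rge0 ?exprn_gt0// subr_ge0 in H.
have [d0|d0] := lerP (dotp x y) 0.
  by rewrite (le_trans d0)// mulr_ge0 ?enorm_ge0.
by rewrite -(@ler_pXn2r _ 2)// nnegrE ?mulr_ge0 ?enorm_ge0// ltW.
Qed.

Lemma normr_dotp x y : `|dotp x y| <= enorm x * enorm y.
Proof.
rewrite ler_norml CauchySchwarz andbT lerNl -dotpNl.
by rewrite (le_trans (CauchySchwarz _ _))// enormN.
Qed.

Lemma enormD x y : enorm (x + y) <= enorm x + enorm y.
Proof.
rewrite -(@ler_pXn2r _ 2) ?nnegrE ?addr_ge0 ?enorm_ge0//.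
rewrite sqr_enorm dotpDl !dotpDr -!sqr_enorm (dotpC y x) sqrrD.
have := CauchySchwarz x y; lra.
Qed.

Lemma enorm_triangle z x y : enorm (x - y) <= enorm (x - z) + enorm (z - y).
Proof. by rewrite (le_trans _ (enormD _ _))// addrA subrK. Qed.

Lemma sqr_enormD x y :
  enorm (x + y) ^+ 2 = enorm x ^+ 2 + 2 * dotp x y + enorm y ^+ 2.
Proof. rewrite !sqr_enorm dotpDl !dotpDr (dotpC y x); ring. Qed.

Lemma enorm_le_mx_norm x : enorm x <= m.+1%:R * `|x|.
Proof.
have xn i : `|x 0 i| <= `|x|.
  rewrite [leRHS]/Num.norm /= mx_normrE.
  by rewrite (@le_bigmax _ _ _ 0 (fun ij => `|x ij.1 ij.2|) (0, i)).
rewrite -(@ler_pXn2r _ 2) ?nnegrE ?mulr_ge0 ?enorm_ge0// sqr_enorm exprMn.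
apply: (@le_trans _ _ (\sum_(i < m) `|x| ^+ 2)).
  apply: ler_sum => i _; rewrite -expr2 -[x 0 i ^+ 2]ger0_norm ?sqr_ge0// normrX.
  by rewrite ler_pXn2r ?nnegrE.
rewrite sumr_const card_ord -[X in X <= _]mulr_natl ler_wpM2r ?sqr_ge0//.
rewrite -natrX ler_nat; apply: (@leq_trans m.+1) => //.
by rewrite expnS leq_pmulr.
Qed.

End EuclideanNorm.

(** * Absolutely continuous functions with a.e. nonpositive derivative *)

Section Derivative.
Context {R : realType} {W : normedModType R}.

(** The first order expansion at s, in which absolute continuity, monotonicity
    and linear maps are easier to handle than in the difference quotient. *)
Lemma is_derive_approxP (X : R -> W) (s : R) (D : W) : is_derive s (1 : R) X D <->
  forall e, 0 < e -> exists2 d, 0 < d & forall r, `|r - s| < d ->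
    `|X r - X s - (r - s) *: D| <= e * `|r - s|.
Proof.
split.
- case=> dX dv e e0.
  have : (fun h => h^-1 *: ((X \o shift s) (h *: 1) - X s)) @ 0^' --> D.
    by rewrite -dv; exact: dX.
  move=> /cvgrPdist_le /(_ e e0) [/= d d0 H]; exists d => // r rs.
  have [->|rs0] := eqVneq r s; first by rewrite !subrr scale0r subr0 !normr0 mulr0.
  have h0 : r - s != 0 by rewrite subr_eq0.
  have := H (r - s); rewrite /ball_/= sub0r normrN => /(_ rs h0).
  rewrite /GRing.scale/= mulr1 subrK -/(GRing.scale _ _) => K.
  rewrite -[X r - X s](@scalerKV _ _ (r - s))// -scalerBr normrZ mulrC.
  by rewrite ler_wpM2r// distrC.
- move=> H.
  have K : (fun h => h^-1 *: ((X \o shift s) (h *: 1) - X s)) @ 0^' --> D.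
    apply/cvgrPdist_le => e e0; have [d d0 {}H] := H e e0.
    exists d => //= h; rewrite /ball_/= sub0r normrN => hd h0.
    have := H (h + s); rewrite addrK => /(_ hd).
    rewrite /GRing.scale/= mulr1 -/(GRing.scale _ _) => {}H.
    rewrite -[D in D - _](@scalerK _ _ h)// -scalerBr normrZ normfV.
    by rewrite ler_pdivrMl ?normr_gt0// distrC mulrC.
  split; first by apply/cvg_ex; exists D.
  exact: cvg_lim.
Qed.

End Derivative.

Section Monotonicity.
Context {R : realType}.
Implicit Types (a b x : R) (h : R -> R) (l : seq (R * R)).

(** Connectedness of [a, b], in the form of Cousin's lemma: the supremum of the
    points where P holds cannot be smaller than b. *)
Lemma itv_induction (P : R -> Prop) a b : a <= b -> P a ->
  (forall c, a <= c <= b -> exists2 d, 0 < d & forall y z,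
     a <= y -> y <= c -> c <= z -> z <= b -> c - d < y -> z < c + d ->
     P y -> P z) ->
  P b.
Proof.
move=> ab Pa step.
pose S := [set x | a <= x <= b /\ P x].
have Sa : S a by split => //; rewrite lexx ab.
have Sb : ubound S b by move=> x [/andP[]].
have hS : has_sup S by split; [exists a|exists b].
have aS : a <= sup S by apply: ub_le_sup => //; exact: hS.2.
have bS : sup S <= b by apply: ge_sup => //; exact: hS.1.
have [|d d0 H] := step (sup S); first by rewrite aS bS.
have [y [/andP[ay yb] Py] dy] := sup_adherent d0 hS.
have yS : y <= sup S.
  by apply: ub_le_sup; [exact: hS.2|split => //; rewrite ay yb].
have [Sltb|] := ltP (sup S) b; last first.
  move=> bS'; have bE : b = sup S by apply/eqP; rewrite eq_le bS bS'.
  by apply: (H y) => //; rewrite bE ?ltrDl// lexx.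
pose z := Num.min b (sup S + d / 2).
have Sz : sup S < z by rewrite lt_min Sltb ltrDl divr_gt0.
have zb : z <= b by rewrite ge_min lexx.
have zd : z < sup S + d.
  by rewrite gt_min; apply/orP; right; rewrite ltrD2l; lra.
have Pz : P z by apply: (H y) => //; exact: ltW.
have : z <= sup S.
  apply: ub_le_sup; first exact: hS.2.
  by split => //; rewrite zb andbT (le_trans aS)// ltW.
by rewrite leNgt Sz.
Qed.

(** A finite family of disjoint intervals inside O, ordered from x down to a:
    the form in which such a family can be extended to the right. *)
Fixpoint stacked (O : set R) a l x : Prop :=
  if l is pq :: l' then
    [/\ pq.1 <= pq.2, pq.2 <= x, `]pq.1, pq.2[ `<=` O & stacked O a l' pq.1]
  else a <= x.

Lemma stacked_le O a l x y : x <= y -> stacked O a l x -> stacked O a l y.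
Proof.
case: l => [|pq l] xy /=; first by move=> ax; exact: le_trans xy.
by case=> ? qx ? ?; split => //; exact: (le_trans qx).
Qed.

Lemma stacked_nth O a l x i : stacked O a l x -> (i < size l)%N ->
  let pq := nth (0, 0) l i in [/\ a <= pq.1, pq.1 <= pq.2 & pq.2 <= x].
Proof.
have aS l' y : stacked O a l' y -> a <= y.
  elim: l' y => [//|pq l' IH] y /= [pq12 qy _ /IH ap].
  by rewrite (le_trans ap)// (le_trans pq12).
elim: l i x => [//|pq l IH] [|i] x /= [pq12 qx _ S].
  by move=> _; split => //; exact: aS S.
rewrite ltnS => /(IH _ _ S)[? ? qp]; split => //.
by rewrite (le_trans qp)// (le_trans pq12).
Qed.

Lemma stacked_nth_lt O a l x i j : stacked O a l x -> (i < j < size l)%N ->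
  (nth (0, 0) l j).2 <= (nth (0, 0) l i).1.
Proof.
elim: l i j x => [|pq l IH] [|i] [|j] x //=; rewrite ?andbF//.
- by move=> [_ _ _ S] /=; rewrite ltnS => /(stacked_nth S)[].
- by move=> [_ _ _ S]; rewrite !ltnS => ij; apply: IH S ij.
Qed.

Lemma stacked_length O a l x : open O -> stacked O a l x ->
  ((\sum_(pq <- l) (pq.2 - pq.1))%:E <= lebesgue_measure O)%E.
Proof.
move=> oO; have mO := open_measurable oO.
suff : stacked O a l x -> ((\sum_(pq <- l) (pq.2 - pq.1))%:E <=
    lebesgue_measure (O `&` `]-oo, x[%classic))%E.
  move=> + S => /(_ S)/le_trans; apply; apply: le_measure; rewrite ?inE//.
  exact: measurableI.
elim: l x => [|pq l IH] x /=; first by rewrite big_nil measure_ge0.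
move=> [pq12 qx pqO S]; rewrite big_cons EFinD.
apply: (@le_trans _ _ (lebesgue_measure `]pq.1, pq.2[%classic +
    lebesgue_measure (O `&` `]-oo, pq.1[%classic))%E).
  apply: leeD; last exact: IH.
  rewrite lebesgue_measure_itv/= lte_fin; case: ltP => //.
  by move=> qp; rewrite lee_fin subr_le0.
rewrite -measureU//; last 2 first.
- exact: measurableI.
- apply/seteqP; split => // y [] /=; rewrite !in_itv/= => /andP[py _] [_ yp].
  by have := lt_trans py yp; rewrite ltxx.
apply: le_measure; rewrite ?inE//; first by apply: measurableU => //; exact: measurableI.
  exact: measurableI.
move=> y [ypq|[Oy yp]]; split => //=; first exact: pqO.
- by move: ypq; rewrite /= !in_itv/= => /andP[_ yq]; exact: lt_le_trans yq qx.
- move: yp; rewrite /= !in_itv/= => yp; exact: lt_le_trans yp (le_trans pq12 qx).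
Qed.

(** The real-valued counterpart of [absolutely_continuous_on]. *)
Definition abs_cont a b h := forall e : R, 0 < e -> exists2 d : R, 0 < d &
  forall (N : nat) (p q : 'I_N -> R),
    (forall i, [/\ a <= p i, p i <= q i & q i <= b]) ->
    trivIset [set: 'I_N] (fun i => `]p i, q i[%classic) ->
    \sum_(i < N) (q i - p i) < d ->
    \sum_(i < N) `|h (q i) - h (p i)| < e.

Lemma abs_cont_stacked a b h : abs_cont a b h -> forall e, 0 < e ->
  exists2 d, 0 < d & forall O l, open O -> stacked O a l b ->
    (lebesgue_measure O < d%:E)%E -> \sum_(pq <- l) `|h pq.2 - h pq.1| < e.
Proof.
move=> ach e e0; have [d d0 H] := ach e e0; exists d => // O l oO S Od.
rewrite (big_nth (0, 0)) big_mkord.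
apply: (H (size l) (fun i => (nth (0, 0) l i).1) (fun i => (nth (0, 0) l i).2)).
- by move=> i; exact: (stacked_nth S).
- move=> i j _ _ [y [/=]]; rewrite !in_itv/= => /andP[piy yqi] /andP[pjy yqj].
  have [ij|ji|/val_inj//] := ltngtP i j.
    have := @stacked_nth_lt _ _ _ _ i j S; rewrite ij ltn_ord => /(_ isT).
    by rewrite leNgt (lt_trans piy).
  have := @stacked_nth_lt _ _ _ _ j i S; rewrite ji ltn_ord => /(_ isT).
  by rewrite leNgt (lt_trans pjy).
- rewrite -lte_fin (le_lt_trans _ Od)//.
  have := stacked_length oO S.
  by rewrite (big_nth (0, 0)) big_mkord.
Qed.

Lemma negligible_set1 (a : R) : lebesgue_measure.-negligible [set a].
Proof. by exists [set a]; split => //; exact: lebesgue_measure_set1. Qed.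

Lemma negligible_open_cover (N : set R) (d : R) : 0 < d ->
  lebesgue_measure.-negligible N ->
  exists O, [/\ open O, N `<=` O & (lebesgue_measure O < d%:E)%E].
Proof.
move=> d0 [A [mA A0 NA]].
have [|O [oO AO Od]] := @lebesgue_regularity_outer R A d mA _ d0.
  by rewrite [X in (X < _)%E]A0 ltry.
exists O; split => //; first exact: subset_trans AO.
rewrite -(setDUK AO) measureU//.
- by rewrite [X in (X + _)%E]A0 add0e.
- by apply: measurableD => //; exact: open_measurable.
- by rewrite setIC; apply/seteqP; split => // y [[]].
Qed.

(** Cover the exceptional null set by an open set O of small measure.  Away
    from O the increments are controlled by the derivative, and the
    increments over disjoint intervals inside O have a small sum by absolute
    continuity.  A gauge argument on [a, b] combines the two estimates. *)
Lemma abs_cont_nonincreasing a b h : a <= b -> abs_cont a b h ->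
  {ae lebesgue_measure, forall s, a < s < b ->
    exists2 D, is_derive s 1 h D & D <= 0} ->
  h b <= h a.
Proof.
move=> ab ach hN; apply/ler_addgt0Pl => e e0.
have e20 : 0 < e / 2 by lra.
pose k := e / 2 / (b - a + 1).
have ba1 : 0 < b - a + 1 by lra.
have k0 : 0 < k by rewrite divr_gt0.
have [d d0 Hd] := abs_cont_stacked ach e20.
have Nab : lebesgue_measure.-negligible
    (~` [set s | a < s < b -> exists2 D, is_derive s 1 h D & D <= 0]
     `|` ([set a] `|` [set b])).
  by apply: negligibleU => //; apply: negligibleU; exact: negligible_set1.
have [ O [oO NO Od]] := negligible_open_cover d0 Nab.
(* the property carried along [a, b]: l collects the steps made inside O *)
pose P x := exists2 l, stacked O a l x &
  h x - h a <= k * (x - a) + \sum_(pq <- l) `|h pq.2 - h pq.1|.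
suff [l S hl] : P b.
  have := Hd O l oO S Od.
  have : k * (b - a) <= e / 2.
    rewrite /k mulrAC ler_pdivrMr// ler_pM2l//; lra.
  lra.
apply: (@itv_induction _ a b) => //.
  by exists [::] => //=; rewrite big_nil !subrr mulr0 addr0.
move=> c /andP[ac cb].
have [Oc|nOc] := pselect (O c).
- have [r /= r0 Hr] : nbhs c O by exact: open_nbhs_nbhs.
  exists r => // y z ay yc cz zb cy zc [l S hl].
  exists ((y, z) :: l) => /=.
  + split => //; first exact: le_trans cz.
    move=> t /=; rewrite in_itv/= => /andP[yt tz]; apply: Hr.
    by rewrite /ball_/= distrC ltr_distl (lt_trans cy yt) (lt_trans tz zc).
  + rewrite big_cons/=.
    have := ler_norm (h z - h y).
    have : k * (y - a) <= k * (z - a) by rewrite ler_pM2l//; lra.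
    lra.
- have ncab : a < c < b.
    apply/andP; split; rewrite lt_neqAle ?ac ?cb andbT; apply/eqP => E.
    + by apply: nOc; apply: NO; right; left.
    + by apply: nOc; apply: NO; right; right.
  have [D Dh D0] : exists2 D, is_derive c 1 h D & D <= 0.
    apply: contrapT => nD; apply: nOc; apply: NO; left => /= H.
    by apply: nD; exact: H.
  have [r r0 Hr] := (is_derive_approxP h c D).1 Dh k k0.
  exists r => // y z ay yc cz zb cy zc [l S hl].
  exists l; first by apply: stacked_le S; exact: le_trans cz.
  have := Hr y; rewrite ltr_norml => /(_ ltac:(by apply/andP; split; lra)).
  have := Hr z; rewrite ltr_norml => /(_ ltac:(by apply/andP; split; lra)).
  rewrite (ger0_norm (_ : 0 <= z - c)) ?subr_ge0//.
  rewrite (ler0_norm (_ : y - c <= 0)) ?subr_le0//.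
  rewrite !ler_norml /GRing.scale/= => /andP[_ H1] /andP[H2 _].
  have H3 : (z - c) * D <= 0 by rewrite mulr_ge0_le0// subr_ge0.
  have H4 : 0 <= (y - c) * D by rewrite mulr_le0// subr_le0.
  have -> : k * (z - a) = k * (z - c) + k * (c - y) + k * (y - a) by ring.
  have H5 : k * - (y - c) = k * (c - y) by ring.
  lra.
Qed.

End Monotonicity.

(** * Primitives of bounded Lebesgue measurable functions *)

Section Primitive.
Context {R : realType}.
Implicit Types (h : R -> R) (A B : set R).
Local Notation mu := (@lebesgue_measure R).

Lemma ae_and (P Q : R -> Prop) : {ae mu, forall s, P s} ->
  {ae mu, forall s, Q s} -> {ae mu, forall s, P s /\ Q s}.
Proof. exact: (@filterI _ _ (ae_filter_ringOfSetsType mu)). Qed.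

Lemma aeS (P Q : R -> Prop) : (forall s, P s -> Q s) ->
  {ae mu, forall s, P s} -> {ae mu, forall s, Q s}.
Proof. exact: (@filterS _ _ (ae_filter_ringOfSetsType mu)). Qed.

Definition lebesgue_measurable A := measurable (A : set (lebesgueType R)).

Lemma borel_lebesgue_measurable A : measurable A -> lebesgue_measurable A.
Proof.
move=> mA; apply: (@sub_sigma_algebra _ setT (completed_algebra_gen mu)); exists A => //.
by exists set0; [exact: negligible_set0|rewrite setU0].
Qed.

(** By the description of the completed sigma-algebra as the Borel sets
    enlarged by negligible sets. *)
Lemma lebesgue_measurable_split A : lebesgue_measurable A ->
  exists B N, [/\ measurable B, measurable N, mu N = 0%E,
    B `<=` A & A `<=` B `|` N].
Proof.
move=> mA; have : completed_algebra_gen mu A.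
  by rewrite -g_sigma_completed_algebra_genE.
move=> [B mB [N' [N [mN N0 NN]] <-]].
by exists B, N; split => // x [|/NN]; [left|right].
Qed.

(** Stated on the rays ]-oo, y[ only, which generate the Borel sets: this is
    the form in which the velocity along a curve is shown to be measurable. *)
Definition lebesgue_measurable01 h :=
  forall y, lebesgue_measurable (`[0, 1] `&` [set s | h s < y]).

Lemma negligible_bigcup_rat (F : rat -> set R) :
  (forall q, mu.-negligible (F q)) -> mu.-negligible (\bigcup_q F q).
Proof.
move=> nF; pose G k := if @choice.unpickle rat k is Some q then F q else set0.
suff : mu.-negligible (\bigcup_k G k).
  apply: negligibleS.
  by move=> x [q _ Fx]; exists (choice.pickle q); [by []|rewrite /G choice.pickleK].
apply: negligible_bigcup => k; rewrite /G; case: choice.unpickle => //.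
exact: negligible_set0.
Qed.

(** The sets h < q, for rational q, are Borel up to null Borel sets, whose
    countable union is the only place where h has to be changed. *)
Lemma borel_modification h : lebesgue_measurable01 h ->
  exists2 h' : R -> R, measurable_fun setT h' &
    {ae mu, forall s, 0 <= s <= 1 -> h' s = h s} /\
    forall s, h' s = h s \/ h' s = 0.
Proof.
move=> mh.
have Hq (q : rat) := lebesgue_measurable_split (mh (ratr q)).
have /choice[BN HBN] q : exists BN : set R * set R,
    [/\ measurable BN.1, measurable BN.2, mu BN.2 = 0%E,
      BN.1 `<=` `[0, 1] `&` [set s | h s < ratr q] &
      `[0, 1] `&` [set s | h s < ratr q] `<=` BN.1 `|` BN.2].
  by have [B [N H]] := Hq q; exists (B, N).
pose N := \bigcup_q (BN q).2.
have mN : measurable N.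
  by apply: bigcupT_measurable_rat => q; have [] := HBN q.
have nN : mu.-negligible N.
  apply: negligible_bigcup_rat => q; have [_ mNq N0 _ _] := HBN q.
  by exists (BN q).2; split.
pose D := (`[0, 1]%classic : set R) `\` N.
have mD : measurable D by apply: measurableD.
exists (h \_ D); last split.
- apply: (measurable_restrictT h mD).1 => // _.
  apply: (measurability _ (RGenInftyO.measurableE R)) => //.
  move=> _ [_ [x ->] <-].
  rewrite (_ : _ `&` _ =
      \bigcup_q (if ratr q <= x then D `&` (BN q).1 else set0)).
    apply: bigcupT_measurable_rat => q; case: ifPn => // _.
    by apply: measurableI => //; have [] := HBN q.
  apply/seteqP; split => s /=.
  + move=> [[Ds nNs] +]; rewrite in_itv/= => hsx.
    have [q] := rat_in_itvoo hsx; rewrite in_itv/= => /andP[hq qx].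
    exists q => //; rewrite (ltW qx); split => //.
    have [_ _ _ _ /(_ s)] := HBN q; case => //.
    by move=> Nq; case: nNs; exists q.
  + move=> [q _]; case: ifPn => // qx [Ds Bs]; split => //.
    have [_ _ _ /(_ s Bs)[_ /= hq] _] := HBN q.
    by rewrite in_itv/= (lt_le_trans hq).
- apply: negligibleS nN => s /= H; apply: contrapT => nNs; apply: H => s01.
  by rewrite patchE mem_set//; split => //=; rewrite in_itv/=.
- by move=> s; rewrite patchE; case: ifPn; [left|right].
Qed.

(** The Lebesgue integral of a Borel modification of h, by the fundamental
    theorem of calculus at Lebesgue points. *)
Lemma primitive h (M : R) : lebesgue_measurable01 h ->
  (forall s, 0 <= s <= 1 -> `|h s| <= M) ->
  exists2 H : R -> R,
    forall s r, 0 <= s -> s <= r -> r <= 1 -> `|H r - H s| <= M * (r - s) &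
    {ae mu, forall s : R, 0 < s < 1 -> is_derive s (1 : R) H (h s)}.
Proof.
move=> mh hM.
have [k0 mk0 [k0h k0E]] := borel_modification mh.
have M0 : 0 <= M by rewrite (le_trans _ (hM 0 _))// lexx ler01.
pose k := k0 \_ `[0, 1]%classic.
have mk : measurable_fun setT k.
  by apply: (measurable_restrictT k0 _).1 => //; exact: measurable_funTS.
have kM s : `|k s| <= M.
  rewrite /k patchE; case: ifPn; rewrite ?normr0//.
  rewrite inE/= in_itv/= => s01.
  by have [->|->] := k0E s; rewrite ?normr0// hM.
have ik A : measurable A -> (mu A < +oo)%E -> mu.-integrable A (EFin \o k).
  move=> mA Aoo; apply: measurable_bounded_integrable => //.
    exact: measurable_funTS.
  exists M; split => [|x Mx s _]; first by rewrite num_real.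
  exact: le_trans (kM s) (ltW Mx).
have iitv y : mu.-integrable `[0, y] (EFin \o k).
  by apply: ik => //; rewrite /= lebesgue_measure_itv/=; case: ifP; rewrite ?ltry.
have lk : locally_integrable [set: R] k.
  split => //; first exact: openT.
  move=> K _ cK; apply: (@le_lt_trans _ _ (\int[mu]_(x in K) (cst M%:E) x)%E).
    have mK := compact_measurable cK.
    apply: ge0_le_integral => //=.
    - by apply/measurable_EFinP; apply: measurableT_comp => //; exact: measurable_funTS.
    - by move=> s _; rewrite lee_fin kM.
  rewrite integral_cst ?lte_mul_pinfty//; first exact: compact_finite_measure.
  exact: compact_measurable.
pose H x := (\int[mu]_(t in `[0, x]) k t)%R.
have := FTC1 iitv lk; rewrite -/H => derH.
exists H.
- move=> s r s0 sr r1; rewrite /H.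
  rewrite (Rintegral_itvB (iitv r)) ?bnd_simp//.
  have mI : measurable (`]s, r]%classic : set R) by [].
  have Ioo : (mu `]s, r]%classic < +oo)%E.
    by rewrite /= lebesgue_measure_itv/=; case: ifP; rewrite ?ltry.
  apply: le_trans; first by apply: le_normr_Rintegral => //; exact: ik.
  apply: (@le_trans _ _ (\int[mu]_(t in `]s, r]) M)%R).
    apply: le_Rintegral => //.
    - by apply: integrable_norm; exact: ik.
    - apply: measurable_bounded_integrable => //.
      by exists M; split => [|x Mx y _]; rewrite ?num_real//= ger0_norm// ltW.
  rewrite Rintegral_cst//= lebesgue_measure_itv/= lte_fin.
  by case: ltP => //= _; rewrite mulr0 mulr_ge0// subr_ge0.
- apply: aeS (ae_and derH k0h) => s /= [+ {}k0h] s01.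
  have s01' : 0 <= s <= 1 by case/andP: s01 => /ltW -> /ltW ->.
  move=> [|dH HE]; first by rewrite lte_fin; case/andP: s01.
  apply: DeriveDef => //; rewrite -derive1E HE /k patchE mem_set ?k0h//= in_itv.
Qed.

End Primitive.

(** * Comparison of curves through their derivatives *)

Lemma subrACA (V : zmodType) (x y z t : V) : x - y - (z - t) = x - z - (y - t).
Proof. by rewrite !opprD !opprK addrACA. Qed.

Section Curves.
Context {R : realType} {m : nat}.
Implicit Types (a b c K M : R) (X Y : R -> 'rV[R]_m) (h G : R -> R).
Local Notation mu := (@lebesgue_measure R).

Lemma abs_cont_lipschitz a b h M :
  (forall s r, a <= s -> s <= r -> r <= b -> `|h r - h s| <= M * (r - s)) ->
  abs_cont a b h.
Proof.
move=> hM e e0.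
have M0 : 0 < `|M| + 1 by rewrite ltr_wpDl.
exists (e / (`|M| + 1)); first by rewrite divr_gt0.
move=> N p q pq _; rewrite ltr_pdivlMr// => lt_e; apply: le_lt_trans lt_e.
rewrite mulrC mulr_sumr; apply: ler_sum => i _.
have [ap pqi qb] := pq i; rewrite (le_trans (hM _ _ _ _ _))//.
by rewrite ler_wpM2r ?subr_ge0// (le_trans (ler_norm M))// lerDl.
Qed.

Lemma abs_contB a b h G : abs_cont a b h -> abs_cont a b G ->
  abs_cont a b (fun s => h s - G s).
Proof.
move=> ach acG e e0; have e2 : 0 < e / 2 by lra.
have [d1 d10 H1] := ach _ e2; have [d2 d20 H2] := acG _ e2.
exists (Num.min d1 d2); first by rewrite lt_min d10.
move=> N p q pq tr; rewrite lt_min => /andP[lt1 lt2].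
rewrite [ltRHS]splitr.
apply: le_lt_trans (ltrD (H1 N p q pq tr lt1) (H2 N p q pq tr lt2)).
rewrite -big_split/=; apply: ler_sum => i _.
by rewrite subrACA ler_normB.
Qed.

Lemma absolutely_continuous_dotp a b X (e : 'rV[R]_m) :
  absolutely_continuous_on a b X -> abs_cont a b (fun s => dotp e (X s)).
Proof.
move=> acX eps eps0.
have M0 : 0 < enorm e + 1 by rewrite ltr_wpDl ?enorm_ge0.
have [d d0 H] := acX (eps / (enorm e + 1)) ltac:(by rewrite divr_gt0).
exists d => // N p q pq tr lt_d; have := H N p q pq tr lt_d.
rewrite ltr_pdivlMr// => lt_e; apply: le_lt_trans lt_e.
rewrite mulrC mulr_sumr; apply: ler_sum => i _.
rewrite -dotpBr (le_trans (normr_dotp _ _))//.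
by rewrite ler_wpM2r ?enorm_ge0// lerDl.
Qed.

Lemma absolutely_continuousS a b a' b' X : a <= a' -> b' <= b ->
  absolutely_continuous_on a b X -> absolutely_continuous_on a' b' X.
Proof.
move=> aa bb acX e e0; have [d d0 H] := acX e e0; exists d => // N p q pq.
apply: H => i; have [ap pqi qb] := pq i.
by split => //; [exact: le_trans ap|exact: le_trans bb].
Qed.

Lemma absolutely_continuousB a b X Y : absolutely_continuous_on a b X ->
  absolutely_continuous_on a b Y ->
  absolutely_continuous_on a b (fun s => X s - Y s).
Proof.
move=> acX acY e e0; have e2 : 0 < e / 2 by lra.
have [d1 d10 H1] := acX _ e2; have [d2 d20 H2] := acY _ e2.
exists (Num.min d1 d2); first by rewrite lt_min d10.
move=> N p q pq tr; rewrite lt_min => /andP[lt1 lt2].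
rewrite [ltRHS]splitr.
apply: le_lt_trans (ltrD (H1 N p q pq tr lt1) (H2 N p q pq tr lt2)).
rewrite -big_split/=; apply: ler_sum => i _.
by rewrite subrACA (le_trans (enormD _ _))// enormN.
Qed.

Definition lipschitz_on M a b X := forall s r, a <= s -> s <= r -> r <= b ->
  enorm (X r - X s) <= M * (r - s).

Lemma lipschitz_onS M a b a' b' X : a <= a' -> b' <= b ->
  lipschitz_on M a b X -> lipschitz_on M a' b' X.
Proof.
move=> aa bb lX s r as_ sr rb.
by apply: lX => //; [exact: le_trans as_|exact: le_trans bb].
Qed.

Lemma lipschitz_on_ac M a b X : lipschitz_on M a b X ->
  absolutely_continuous_on a b X.
Proof.
move=> lX e e0.
have M0 : 0 < `|M| + 1 by rewrite ltr_wpDl.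
exists (e / (`|M| + 1)); first by rewrite divr_gt0.
move=> N p q pq _; rewrite ltr_pdivlMr// => lt_e; apply: le_lt_trans lt_e.
rewrite mulrC mulr_sumr; apply: ler_sum => i _.
have [ap pqi qb] := pq i; rewrite (le_trans (lX _ _ _ _ _))//.
by rewrite ler_wpM2r ?subr_ge0// (le_trans (ler_norm M))// lerDl.
Qed.

Lemma is_derive_dotp X (s : R) (D e : 'rV[R]_m) : is_derive s (1 : R) X D ->
  is_derive s (1 : R) (fun r => dotp e (X r)) (dotp e D).
Proof.
move=> /is_derive_approxP XD; apply/is_derive_approxP => eps eps0.
have M0 : 0 < (enorm e + 1) * m.+1%:R by rewrite mulr_gt0// ltr_wpDl ?enorm_ge0.
have [d d0 H] := XD (eps / ((enorm e + 1) * m.+1%:R)) ltac:(by rewrite divr_gt0).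
exists d => // r rs; have {}H := H r rs.
have -> : (r - s) *: dotp e D = dotp e ((r - s) *: D) by rewrite dotpZr.
rewrite -!dotpBr (le_trans (normr_dotp _ _))//.
rewrite (le_trans (ler_wpM2l (enorm_ge0 _) (enorm_le_mx_norm _)))//.
apply: (@le_trans _ _ ((enorm e + 1) *
    (m.+1%:R * (eps / ((enorm e + 1) * m.+1%:R) * `|r - s|)))).
  apply: ler_pM; rewrite ?enorm_ge0 ?mulr_ge0//; first by rewrite lerDl.
  by rewrite ler_pM2l.
rewrite le_eqVlt; apply/orP; left; apply/eqP.
have p0 : enorm e + 1 != 0 by rewrite gt_eqF// ltr_wpDl ?enorm_ge0.
have q0 : m.+1%:R != 0 :> R by rewrite gt_eqF.
by move: (enorm e + 1) (m.+1%:R : R) p0 q0 => p q p0 q0; field; rewrite p0 q0.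
Qed.

(** The absolutely continuous function <e, X> - G is nonincreasing.  All the
    estimates on trajectories go through this comparison. *)
Lemma dotp_increment_le X G a b e : a <= b ->
  absolutely_continuous_on a b X -> abs_cont a b G ->
  {ae mu, forall s : R, a < s < b -> exists D, exists2 g,
     is_derive s (1 : R) X D /\ is_derive s (1 : R) G g & dotp e D <= g} ->
  dotp e (X b - X a) <= G b - G a.
Proof.
move=> ab acX acG H.
suff : dotp e (X b) - G b <= dotp e (X a) - G a by rewrite dotpBr; lra.
apply: (@abs_cont_nonincreasing _ a b (fun s => dotp e (X s) - G s)) => //.
  by apply: abs_contB => //; exact: absolutely_continuous_dotp.
apply: aeS H => s + sab => /(_ sab)[D [g [DX DG] Dg]].
exists (dotp e D - g); last by rewrite subr_le0.
by apply: is_deriveB => //; exact: is_derive_dotp.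
Qed.

(** Take for e the increment of X, and |e| G in place of G. *)
Lemma enorm_increment_le X G a b : a <= b ->
  absolutely_continuous_on a b X -> abs_cont a b G ->
  {ae mu, forall s : R, a < s < b -> exists D, exists2 g,
     is_derive s (1 : R) X D /\ is_derive s (1 : R) G g & enorm D <= g} ->
  G a <= G b ->
  enorm (X b - X a) <= G b - G a.
Proof.
move=> ab acX acG H Gab.
set e := X b - X a.
have [->|e0] := eqVneq (enorm e) 0; first by rewrite subr_ge0.
have ep : 0 < enorm e by rewrite lt_def e0 enorm_ge0.
rewrite -(ler_pM2l ep) -expr2 sqr_enorm {2}/e mulrBr.
apply: (@dotp_increment_le X (fun s => enorm e * G s)) => //.
- move=> eps eps0; have [d d0 K] := acG (eps / enorm e) ltac:(by rewrite divr_gt0).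
  exists d => // N p q pq tr lt_d; have := K N p q pq tr lt_d.
  rewrite ltr_pdivlMr// => lt_e; apply: le_lt_trans lt_e.
  rewrite mulrC mulr_sumr; apply: ler_sum => i _.
  by rewrite -mulrBr normrM ger0_norm ?enorm_ge0.
- apply: aeS H => s + sab => /(_ sab)[D [g [DX DG] Dg]].
  exists D; exists (enorm e * g).
    split => //; exact: (@is_deriveZ _ _ _ G (enorm e) s 1 g).
  by rewrite (le_trans (CauchySchwarz _ _))// ler_wpM2l ?enorm_ge0.
Qed.

Lemma derivative_bound_lipschitz X a b M : 0 <= M ->
  absolutely_continuous_on a b X ->
  {ae mu, forall s : R, a < s < b -> exists2 D,
     is_derive s (1 : R) X D & enorm D <= M} ->
  lipschitz_on M a b X.
Proof.
move=> M0 acX H s r as_ sr rb; rewrite mulrBr.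
apply: (@enorm_increment_le X (fun s => M * s)) => //.
- exact: absolutely_continuousS acX.
- apply: (@abs_cont_lipschitz _ _ _ M) => p q _ pq _.
  by rewrite -mulrBr normrM !ger0_norm// subr_ge0.
- apply: aeS H => y + /andP[sy yr].
  rewrite (le_lt_trans as_ sy) (lt_le_trans yr rb) => /(_ isT)[D DX DM].
  exists D; exists M => //; split => //.
  have := @is_deriveZ _ _ _ (@id R) M y 1 1 (is_derive_id _ _).
  by rewrite /GRing.scale/= mulr1.
- by rewrite ler_wpM2l.
Qed.

Lemma is_derive_weight K c a (s : R) :
  is_derive s (1 : R) (fun r => K / 2 * expR (2 * c * (r - a)))
    (c * K * expR (2 * c * (s - a))).
Proof.
have d1 : is_derive s (1 : R) (fun r : R => 2 * c * (r - a)) (2 * c).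
  have := @is_deriveZ _ _ _ (fun r : R => r - a) (2 * c) s 1 1.
  rewrite /GRing.scale/= mulr1; apply.
  have := @is_deriveB _ _ _ (@id R) (cst a) s 1 1 0 _ _.
  by rewrite subr0; apply.
have d2 := @is_derive1_comp _ expR (fun r : R => 2 * c * (r - a)) s _ _
  (is_derive_expR _) d1.
have := @is_deriveZ _ _ _ _ (K / 2) s 1 _ d2.
rewrite /GRing.scale/=.
rewrite (_ : K / 2 * _ = c * K * expR (2 * c * (s - a)))//.
by field.
Qed.

Lemma expR_lipschitz (b x y : R) : x <= y -> y <= b ->
  `|expR y - expR x| <= expR b * (y - x).
Proof.
move=> xy yb; rewrite ger0_norm ?subr_ge0 ?ler_expR//.
apply: (@le_trans _ _ (expR y * (y - x))).
  have := expR_ge1Dx (x - y); rewrite -(ler_pM2l (expR_gt0 y)) -expRD.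
  rewrite (_ : y + (x - y) = x); last by ring.
  rewrite mulrDr mulr1 mulrBr mulrBr; lra.
by rewrite ler_wpM2r ?subr_ge0// ler_expR.
Qed.

(** The weight exp(2c(s - a)) turns the integral operator of a c-Lipschitz
    equation into a contraction of ratio 1/2. *)
Lemma weighted_increment X a b c K : 0 <= c -> 0 <= K -> a <= b ->
  absolutely_continuous_on a b X ->
  {ae mu, forall s : R, a < s < b -> exists2 D,
     is_derive s (1 : R) X D & enorm D <= c * K * expR (2 * c * (s - a))} ->
  forall s, a <= s <= b ->
  enorm (X s) <= enorm (X a) + K / 2 * expR (2 * c * (s - a)).
Proof.
move=> c0 K0 ab acX H s /andP[as_ sb].
pose G r := K / 2 * expR (2 * c * (r - a)).
have nG r q : r <= q -> G r <= G q.
  move=> rq; rewrite ler_wpM2l ?divr_ge0// ler_expR ler_wpM2l ?mulr_ge0//.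
  by rewrite lerD2r.
have : enorm (X s - X a) <= G s - G a.
  apply: enorm_increment_le => //; last exact: nG.
  - exact: absolutely_continuousS acX.
  - apply: (@abs_cont_lipschitz _ _ _
      (K / 2 * expR (2 * c * (s - a)) * (2 * c))) => p q ap pq qs.
    rewrite -mulrBr normrM (ger0_norm (_ : 0 <= K / 2)) ?divr_ge0//.
    rewrite -!mulrA ler_wpM2l// ler_wpM2l ?invr_ge0//.
    rewrite (le_trans (@expR_lipschitz (2 * c * (s - a)) _ _ _ _))//.
    + by rewrite !ler_wpM2l// lerD2r.
    + by rewrite -mulrA !ler_wpM2l// lerD2r.
    + by rewrite !mulrA le_eqVlt; apply/orP; left; apply/eqP; ring.
  - apply: aeS H => y + /andP[sy yr].
    rewrite sy (lt_le_trans yr sb) => /(_ isT)[D DX DM].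
    exists D; exists (c * K * expR (2 * c * (y - a))) => //; split => //.
    exact: is_derive_weight.
have : 0 <= G a by rewrite mulr_ge0 ?divr_ge0 ?expR_ge0.
have := enorm_triangle (X a) (X s) 0; rewrite !subr0 -/(G s); lra.
Qed.

(** Gronwall's inequality with a factor 2: bound X by K exp(2c(s - a)) with
    the best constant K, and let the contraction improve it. *)
Lemma gronwall X a b c M : 0 <= c -> a <= b ->
  lipschitz_on M a b X ->
  {ae mu, forall s : R, a < s < b -> exists2 D,
     is_derive s (1 : R) X D & enorm D <= c * enorm (X s)} ->
  enorm (X b) <= 2 * expR (2 * c * (b - a)) * enorm (X a).
Proof.
move=> c0 ab lX H.
pose w s := expR (2 * c * (s - a)).
have w0 s : 0 < w s by exact: expR_gt0.
have w1 s : a <= s -> 1 <= w s.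
  by move=> as_; rewrite -expR0 ler_expR !mulr_ge0// subr_ge0.
pose S := [set y | exists2 s, a <= s <= b & y = enorm (X s) / w s].
have Sa : S (enorm (X a)).
  by exists a; rewrite ?lexx// /w subrr mulr0 expR0 divr1.
have hS : has_sup S.
  split; first by exists (enorm (X a)).
  exists (enorm (X a) + `|M| * (b - a)) => _ [s /andP[as_ sb] ->].
  rewrite ler_pdivrMr// (@le_trans _ _ (enorm (X a) + `|M| * (b - a)))//; last first.
    by rewrite ler_peMr ?w1// addr_ge0 ?enorm_ge0// mulr_ge0// subr_ge0.
  have := enorm_triangle (X a) (X s) 0; rewrite !subr0 => /le_trans; apply.
  rewrite addrC lerD2l (le_trans (lX _ _ _ _ _))//.
  rewrite (@le_trans _ _ (`|M| * (s - a)))//.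
    by rewrite ler_wpM2r ?subr_ge0// ler_norm.
  by rewrite ler_wpM2l// lerD2r.
pose K := sup S.
have SK s : a <= s <= b -> enorm (X s) <= K * w s.
  move=> sab; rewrite -ler_pdivrMr//; apply: ub_le_sup; first exact: hS.2.
  by exists s.
have K0 : 0 <= K.
  by apply: le_trans (enorm_ge0 (X a)) _; apply: ub_le_sup => //; exact: hS.2.
have HK : K <= enorm (X a) + K / 2.
  apply: ge_sup; first exact: hS.1.
  move=> _ [s sab ->]; rewrite ler_pdivrMr//.
  apply: le_trans (@weighted_increment X a b c K c0 K0 ab _ _ s sab) _.
  - exact: lipschitz_on_ac lX.
  - apply: aeS H => y + yab => /(_ yab)[D DX Dc]; exists D => //.
    rewrite (le_trans Dc)// -mulrA ler_wpM2l// SK//.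
    by case/andP: yab => /ltW -> /ltW ->.
  - rewrite [leRHS]mulrDl lerD2r ler_peMr ?enorm_ge0//.
    by apply: w1; case/andP: sab.
apply: (le_trans (SK b _)); first by rewrite ab lexx.
rewrite -mulrA [_ * enorm _]mulrC mulrA; apply: ler_wpM2r; first exact/ltW.
lra.
Qed.

End Curves.

(** * Trajectories *)

Section GeometricLimit.
Context {R : realType} {m : nat}.

Lemma lt_pow2 (x : R) : exists k, x < 2 ^+ k.
Proof.
exists (Num.bound `|x|); rewrite (le_lt_trans (ler_norm x))//.
rewrite (lt_trans (archi_boundP (normr_ge0 x)))// -natrX ltr_nat.
exact: ltn_expl.
Qed.

Lemma geometric_lt (B e : R) : 0 < e -> exists k, B / 2 ^+ k < e.
Proof.
move=> e0; have [k Bk] := lt_pow2 (B / e); exists k.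
by rewrite ltr_pdivrMr ?exprn_gt0// mulrC -ltr_pdivrMr.
Qed.

Lemma geometric_le0 (x B : R) : (forall k, x <= B / 2 ^+ k) -> x <= 0.
Proof.
move=> H; rewrite leNgt; apply/negP => /(geometric_lt B)[k].
by rewrite ltNge H.
Qed.

Lemma geometric_limit (u : nat -> 'rV[R]_m) (B : R) :
  (forall k, enorm (u k.+1 - u k) <= B / 2 ^+ k) ->
  exists L, forall k, enorm (L - u k) <= 2 * B / 2 ^+ k.
Proof.
move=> H.
have B0 : 0 <= B.
  by have := H 0%N; rewrite expr0 divr1; apply: le_trans; exact: enorm_ge0.
have p0 k : 0 < 2 ^+ k :> R by rewrite exprn_gt0.
have far k j : enorm (u (k + j)%N - u k) <= 2 * B / 2 ^+ k - 2 * B / 2 ^+ (k + j).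
  elim: j => [|j IH]; first by rewrite addn0 !subrr enorm0.
  rewrite (le_trans (enorm_triangle (u (k + j)%N) _ _))// addnS.
  have := H (k + j)%N.
  suff -> : 2 * B / 2 ^+ (k + j).+1 = B / 2 ^+ (k + j) by move: IH; lra.
  rewrite exprS; field; by rewrite gt_eqF.
have {}far k j : (k <= j)%N -> enorm (u j - u k) <= 2 * B / 2 ^+ k.
  move=> kj; have := far k (j - k)%N; rewrite subnKC// => /le_trans; apply.
  by rewrite gerBl divr_ge0 ?mulr_ge0// ltW.
have cu : cvg (u @ \oo).
  apply/cauchy_cvgP; apply: cauchy_exP => e e0.
  have [k ke] := geometric_lt (2 * B) e0.
  exists (u k); exists k => // j /= kj.
  rewrite -ball_normE/= distrC.
  exact: le_lt_trans (mx_norm_le_enorm _) (le_lt_trans (far _ _ kj) ke).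
exists (lim (u @ \oo)) => k; apply/ler_addgt0Pl => e e0.
have e1 : 0 < e / m.+1%:R by rewrite divr_gt0.
have /cvgrPdist_lt /(_ _ e1)[N _ HN] := cu.
pose j := maxn N k.
have := HN j (leq_maxl _ _) => Lj.
rewrite (le_trans (enorm_triangle (u j) _ _))// lerD ?far ?leq_maxr//.
rewrite (le_trans (enorm_le_mx_norm _))// mulrC -ler_pdivlMr//.
exact: ltW.
Qed.

End GeometricLimit.

Section Dynamics.
Context {R : realType} {n k l : nat}.
Variables (U : set 'rV[R]_k) (V : set 'rV[R]_l).
Variable f : R -> 'rV[R]_n -> 'rV[R]_k -> 'rV[R]_l -> 'rV[R]_n.
Implicit Types (X Y : R -> 'rV[R]_n) (u : R -> 'rV[R]_k) (v : R -> 'rV[R]_l).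
Local Notation mu := (@lebesgue_measure R).

(** The part of the standing assumptions used by the differential equation,
    with its constants made explicit. *)
Record regular_dynamics (M c : R) : Prop := RegularDynamics {
  bound_ge0 : 0 <= M ;
  lip_ge0 : 0 <= c ;
  bound_dyn : forall (t : R) x a b, 0 <= t <= 1 -> U a -> V b ->
    enorm (f t x a b) <= M ;
  lip_dyn : forall (t s : R) x y a b, 0 <= t <= 1 -> 0 <= s <= 1 -> U a -> V b ->
    enorm (f t x a b - f s y a b) <= c * (`|t - s| + enorm (x - y)) ;
  meas_dyn : forall u v x, controls U u -> controls V v ->
    measurable01 (fun t => f t x (u t) (v t)) }.

Lemma standing_regular : standing_assumptions U V f ->
  exists M c, regular_dynamics M c.
Proof.
case=> [[M fM] [c c0 fL] _ fm]; exists `|M|, c; split => //.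
by move=> t x u v t01 Uu Vv; rewrite (le_trans (fM t x u v t01 Uu Vv))// ler_norm.
Qed.

Variables (M c : R).
Hypothesis reg : regular_dynamics M c.

Let M0 : 0 <= M. Proof. by case: reg. Qed.
Let c0 : 0 <= c. Proof. by case: reg. Qed.

Lemma measurable01_coord (g : R -> 'rV[R]_n) j : measurable01 g ->
  measurable_fun (`[0, 1]%classic : set (lebesgueType R)) (fun s => g s 0 j).
Proof.
move=> mg mD; apply: (measurability _ (RGenInftyO.measurableE R)) => //.
move=> _ [_ [x ->] <-].
have : measurable ([set z : 'rV[R]_n | z 0 j < x] : set (borelType R n)).
  apply: sub_sigma_algebra => /=.
  rewrite (_ : [set _ | _] = (fun z : 'rV[R]_n => z 0 j) @^-1` `]-oo, x[%classic).
    apply: open_comp; last exact: lray_open.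
    by move=> z _; exact: coord_continuous.
  by apply/seteqP; split => z /=; rewrite in_itv.
move=> /(mg mD); congr measurable; apply/seteqP; split => z /=;
  by rewrite !in_itv.
Qed.

Lemma measurable_fun_borel_lebesgue (h : R -> R) : measurable_fun setT h ->
  measurable_fun (`[0, 1]%classic : set (lebesgueType R)) h.
Proof.
move=> mh _ B mB; apply: borel_lebesgue_measurable.
by apply: measurableI => //; rewrite -[X in measurable X]setTI; exact: mh.
Qed.

Lemma rat_near01 (s d : R) : 0 <= s <= 1 -> 0 < d ->
  exists q : rat, 0 <= (ratr q : R) <= 1 /\ `|s - ratr q| < d.
Proof.
move=> /andP[s0 s1] d0.
have [|q] := @rat_in_itvoo R (Num.max 0 (s - d)) (Num.min 1 (s + d)).
  rewrite lt_min !gt_max; apply/andP; split; apply/andP; split; lra.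
rewrite in_itv/= lt_min gt_max => /andP[/andP[q0 sq] /andP[q1 qs]].
exists q; split; first by rewrite !ltW.
by rewrite distrC ltr_distl sq qs.
Qed.

Lemma lipschitz_on_norm X a b s r : lipschitz_on M a b X ->
  a <= s <= b -> a <= r <= b -> enorm (X s - X r) <= M * `|s - r|.
Proof.
move=> lX /andP[as_ sb] /andP[ar rb]; have [sr|rs] := leP s r.
  by rewrite enormB ler0_norm ?subr_le0// opprB lX.
by rewrite ger0_norm ?subr_ge0 ?lX// ltW.
Qed.

(** The j-th coordinate is the infimum, over rational r in [0, 1], of the
    measurable functions s |-> f(s, X(r), u(s), v(s))_j + c M |s - r|. *)
Lemma measurable_velocity X u v j : lipschitz_on M 0 1 X ->
  controls U u -> controls V v ->
  lebesgue_measurable01 (fun s => f s (X s) (u s) (v s) 0 j).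
Proof.
move=> lX cu cv y.
have near s (r : rat) : 0 <= s <= 1 -> 0 <= (ratr r : R) <= 1 ->
    `|f s (X s) (u s) (v s) 0 j - f s (X (ratr r)) (u s) (v s) 0 j| <=
    c * M * `|s - ratr r|.
  move=> s01 r01.
  have := enorm_coord (f s (X s) (u s) (v s) - f s (X (ratr r)) (u s) (v s)) j.
  rewrite !mxE => /le_trans; apply.
  have := lip_dyn reg (X s) (X (ratr r)) s01 s01 (cu.1 _ s01) (cv.1 _ s01).
  move=> /le_trans; apply; rewrite subrr normr0 add0r -mulrA ler_wpM2l//.
  exact: (lipschitz_on_norm lX).
rewrite (_ : _ `&` _ = \bigcup_(r : rat)
    (if 0 <= (ratr r : R) <= 1 then `[0, 1] `&` [set s |
      f s (X (ratr r)) (u s) (v s) 0 j + c * M * `|s - ratr r| < y]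
     else set0)).
  apply: (@bigcupT_measurable_rat _ (lebesgueType R)) => r.
  case: ifPn => // _.
  have mg : measurable_fun (`[0, 1]%classic : set (lebesgueType R))
    ((fun s => f s (X (ratr r)) (u s) (v s) 0 j) \+
     (fun s => c * M * `|s - ratr r|)).
    apply: measurable_funD.
      by apply: measurable01_coord; exact: meas_dyn reg _ _ _ cu cv.
    apply: measurable_fun_borel_lebesgue.
    apply: measurable_funM => //; apply: measurableT_comp => //.
    exact: measurable_funB.
  have mD : measurable (`[0, 1]%classic : set (lebesgueType R)).
    exact: borel_lebesgue_measurable.
  have := mg mD `]-oo, y[%classic (measurable_itv _).
  by congr measurable; apply/seteqP; split => z /=; rewrite !in_itv.
apply/seteqP; split => s /=.
- move=> []; rewrite in_itv/= => s01 sy.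
  have d0 : 0 < (y - f s (X s) (u s) (v s) 0 j) / (2 * (c * M) + 1).
    by rewrite divr_gt0 ?subr_gt0// ltr_wpDl// !mulr_ge0.
  have [r [r01 srd]] := rat_near01 s01 d0.
  exists r => //=; rewrite r01/=; split; first by rewrite in_itv.
  move: srd; rewrite ltr_pdivlMr; last by rewrite ltr_wpDl// !mulr_ge0.
  have := near s r s01 r01; rewrite ler_norml => /andP[].
  have := normr_ge0 (s - ratr r).
  by move: (`|s - ratr r|) => d; lra.
- move=> [r _]; case: ifPn => // r01 [].
  rewrite in_itv/= => s01 sy; split => //.
  have := near s r s01 r01; rewrite ler_norml => /andP[_].
  move: sy; lra.
Qed.

Lemma is_derive_rV (X : R -> 'rV[R]_n) (s : R) (D : 'rV[R]_n) :
  (forall j, is_derive s (1 : R) (fun r => X r 0 j) (D 0 j)) ->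
  is_derive s (1 : R) X D.
Proof.
move=> H; have dX : derivable X s 1.
  by apply/derivable_mxP => i j; rewrite ord1; have [] := H j.
apply: DeriveDef => //; rewrite derive_mx//; apply/matrixP => i j.
by rewrite mxE !ord1; have [] := H j.
Qed.

Lemma ae_ord (P : 'I_n -> R -> Prop) : (forall j, {ae mu, forall s, P j s}) ->
  {ae mu, forall s, forall j, P j s}.
Proof.
exact: (@filter_forall _ _ _ _ (ae_filter_ringOfSetsType mu)).
Qed.

(** One step of the successive approximations.  The velocity along X is
    integrated over all of [0, 1], so that the next curve is again Lipschitz
    there and the step can be iterated. *)
Lemma picard_step t x X u v : 0 <= t <= 1 -> lipschitz_on M 0 1 X ->
  controls U u -> controls V v ->
  exists Y, [/\ lipschitz_on M 0 1 Y, Y t = x &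
    {ae mu, forall s : R, 0 < s < 1 ->
       is_derive s (1 : R) Y (f s (X s) (u s) (v s))}].
Proof.
move=> t01 lX cu cv.
have fM j s : 0 <= s <= 1 -> `|f s (X s) (u s) (v s) 0 j| <= M.
  move=> s01; rewrite (le_trans (enorm_coord _ _))//.
  by apply: (bound_dyn reg) => //; [exact: cu.1|exact: cv.1].
have /choice[H HH] j : exists H : R -> R,
    (forall s r, 0 <= s -> s <= r -> r <= 1 -> `|H r - H s| <= M * (r - s)) /\
    {ae mu, forall s : R, 0 < s < 1 ->
       is_derive s (1 : R) H (f s (X s) (u s) (v s) 0 j)}.
  have [H H1 H2] := primitive (measurable_velocity j lX cu cv) (fM j).
  by exists H.
pose Y s : 'rV[R]_n := x + \row_j (H j s - H j t).
have dY : {ae mu, forall s : R, 0 < s < 1 ->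
    is_derive s (1 : R) Y (f s (X s) (u s) (v s))}.
  have : {ae mu, forall s : R, forall j, 0 < s < 1 ->
      is_derive s (1 : R) (H j) (f s (X s) (u s) (v s) 0 j)}.
    by apply: (@ae_ord (fun j s => 0 < s < 1 -> _)) => j; have [] := HH j.
  apply: aeS => s dH s01; apply: is_derive_rV => j.
  rewrite (_ : (fun _ => _) = (fun r => x 0 j - H j t + H j r)).
    have dj := dH j s01.
    have := @is_deriveD _ _ _ (cst (x 0 j - H j t)) (H j) s 1 0 _ _ dj.
    by rewrite add0r; apply.
  by apply/funext => r; rewrite !mxE; ring.
exists Y; split => //; last by rewrite /Y (_ : \row__ _ = 0) ?addr0//;
  apply/rowP => j; rewrite !mxE subrr.
apply: derivative_bound_lipschitz => //.
- apply: (@lipschitz_on_ac _ _ (n.+1%:R * M)) => s r s0 sr r1.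
  rewrite (le_trans (enorm_le_mx_norm _))// -mulrA ler_wpM2l//.
  rewrite [leLHS]/Num.norm /= mx_normrE.
  apply: bigmax_le => [|[i j] _ /=]; first by rewrite mulr_ge0// subr_ge0.
  rewrite ord1 !mxE (_ : _ - _ = H j r - H j s); last by ring.
  by have [+ _] := HH j; apply.
- apply: aeS dY => s + s01 => /(_ s01) dYs; exists (f s (X s) (u s) (v s)) => //.
  have s01' : 0 <= s <= 1 by case/andP: s01 => /ltW -> /ltW ->.
  by apply: (bound_dyn reg) => //; [exact: cu.1|exact: cv.1].
Qed.

End Dynamics.

Section Trajectories.
Context {R : realType} {n k l : nat}.
Variables (U : set 'rV[R]_k) (V : set 'rV[R]_l).
Variable f : R -> 'rV[R]_n -> 'rV[R]_k -> 'rV[R]_l -> 'rV[R]_n.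
Implicit Types (X Y : R -> 'rV[R]_n) (u : R -> 'rV[R]_k) (v : R -> 'rV[R]_l).
Local Notation mu := (@lebesgue_measure R).
Variables (M c : R).
Hypothesis reg : regular_dynamics U V f M c.

Let M0 : 0 <= M. Proof. by case: reg. Qed.
Let c0 : 0 <= c. Proof. by case: reg. Qed.

(** Successive approximations converge geometrically on [t, 1]; the limit is
    frozen before t so as to be Lipschitz on [0, 1]. *)
Lemma trajectory_exists t x u v : 0 <= t <= 1 -> controls U u -> controls V v ->
  exists X, is_trajectory f t x u v X.
Proof.
move=> t01 cu cv; have /andP[t0 t1] := t01.
have /choice[T HT] X : exists Y, lipschitz_on M 0 1 X ->
    [/\ lipschitz_on M 0 1 Y, Y t = x &
      {ae mu, forall s : R, 0 < s < 1 ->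
         is_derive s (1 : R) Y (f s (X s) (u s) (v s))}].
  have [lX|nlX] := pselect (lipschitz_on M 0 1 X); last by exists (cst 0).
  by have [Y HY] := picard_step reg x t01 lX cu cv; exists Y.
pose Xs j := iter j T (cst x).
have lipX j : lipschitz_on M 0 1 (Xs j).
  elim: j => [|j IH]; last by have [] := HT _ IH.
  by move=> s r s0 sr r1; rewrite subrr enorm0 mulr_ge0// subr_ge0.
have Xt j : Xs j t = x by case: j => // j; have [] := HT _ (lipX j).
pose w s := expR (2 * c * (s - t)).
have w0 s : 0 < w s by exact: expR_gt0.
have w1 s : t <= s -> 1 <= w s.
  by move=> ts; rewrite -expR0 ler_expR !mulr_ge0// subr_ge0.
have ww s : s <= 1 -> w s <= w 1.
  by move=> s1; rewrite ler_expR ler_wpM2l ?mulr_ge0// lerD2r.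
have Ulip s y z : 0 <= s <= 1 ->
    enorm (f s y (u s) (v s) - f s z (u s) (v s)) <= c * enorm (y - z).
  move=> s01; have := lip_dyn reg y z s01 s01 (cu.1 _ s01) (cv.1 _ s01).
  by rewrite subrr normr0 add0r.
have contract X Y K : 0 <= K -> lipschitz_on M 0 1 X -> lipschitz_on M 0 1 Y ->
    (forall s, t <= s <= 1 -> enorm (X s - Y s) <= K * w s) ->
    forall s, t <= s <= 1 -> enorm (T X s - T Y s) <= K / 2 * w s.
  move=> K0 lX lY XYK s sb.
  have [lTX TXt dTX] := HT X lX; have [lTY TYt dTY] := HT Y lY.
  have := @weighted_increment _ _ (fun r => T X r - T Y r) t 1 c K c0 K0 t1 _ _ s sb.
  rewrite TXt TYt subrr enorm0 add0r; apply.
    apply: absolutely_continuousB; apply: (@lipschitz_on_ac _ _ M).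
      exact: lipschitz_onS lTX.
    exact: lipschitz_onS lTY.
  apply: aeS (ae_and dTX dTY) => r /= [d1 d2] /andP[tr r1].
  have r01 : 0 < r < 1 by rewrite (le_lt_trans t0).
  exists (f r (X r) (u r) (v r) - f r (Y r) (u r) (v r)).
    by apply: is_deriveB; [exact: d1|exact: d2].
  have r01' : 0 <= r <= 1 by case/andP: r01 => /ltW -> /ltW ->.
  rewrite (le_trans (Ulip _ _ _ r01'))// -mulrA ler_wpM2l//.
  by apply: XYK; rewrite (ltW tr) (ltW r1).
(* the weight cancels the ratio c of the integral operator, leaving 1/2 *)
have near j s : t <= s <= 1 -> enorm (Xs j.+1 s - Xs j s) <= M / 2 ^+ j * w s.
  elim: j s => [|j IH] s sb.
    have /andP[ts s1] := sb; rewrite expr0 divr1.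
    rewrite (_ : Xs 0%N s = Xs 1%N t); last by rewrite Xt.
    rewrite (le_trans (lipX 1%N t s _ _ _))// ler_wpM2l//.
    rewrite (le_trans _ (w1 s ts))//; lra.
  rewrite exprSr invfM mulrA; apply: (contract (Xs j.+1) (Xs j)) => //.
  by rewrite divr_ge0// exprn_ge0.
pose B := M * w 1.
have B0 : 0 <= B by rewrite mulr_ge0// ltW.
have /choice[L HL] : forall s, exists Ls, t <= s <= 1 ->
    forall j, enorm (Ls - Xs j s) <= 2 * B / 2 ^+ j.
  move=> s; have [sb|nsb] := pselect (t <= s <= 1); last by exists 0.
  have [|Ls HLs] := @geometric_limit _ _ (fun j => Xs j s) B; last by exists Ls.
  move=> j; rewrite (le_trans (near j s sb))// mulrAC ler_wpM2r ?invr_ge0 ?exprn_ge0//.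
  by rewrite ler_wpM2l// ww//; case/andP: sb.
(* L is meaningful on [t, 1] only *)
pose X s := L (Num.max s t).
have XL s : t <= s -> X s = L s by move=> ts; rewrite /X max_l.
have lX : lipschitz_on M 0 1 X.
  move=> s r s0 sr r1; rewrite /X.
  have : t <= Num.max s t by rewrite le_max lexx orbT.
  have : Num.max r t <= 1 by rewrite ge_max r1.
  have : Num.max s t <= Num.max r t.
    by rewrite ge_max !le_max sr lexx orbT.
  have : Num.max r t - Num.max s t <= r - s.
    case: (leP s t) => st; case: (leP r t) => rt; lra.
  move: (Num.max s t) (Num.max r t) => s' r' le_rs sr' r1' ts'.
  rewrite -subr_le0; apply: (@geometric_le0 _ _ (4 * B)) => j.
  rewrite lerBlDr (le_trans (enorm_triangle (Xs j r') _ _))//.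
  rewrite (le_trans (lerD (lexx _) (enorm_triangle (Xs j s') _ _)))//.
  have := HL r'; rewrite r1' (le_trans ts' sr') => /(_ isT j).
  have := HL s'; rewrite ts' (le_trans sr' r1') => /(_ isT j).
  rewrite (enormB (L s')).
  have := lipX j s' r' (le_trans t0 ts') sr' r1'.
  have : M * (r' - s') <= M * (r - s) by rewrite ler_wpM2l.
  by rewrite -!mulrA; lra.
have [lY Yt dY] := HT X lX.
have YX s : t <= s <= 1 -> T X s = X s.
  move=> sb; have /andP[ts s1] := sb.
  apply/eqP; rewrite -subr_eq0; apply/eqP; apply: enorm_eq0; apply/eqP.
  rewrite eq_le enorm_ge0 andbT; apply: (@geometric_le0 _ _ (2 * B * w 1 + B)) => j.
  rewrite (le_trans (enorm_triangle (Xs j.+1 s) _ _))//.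
  have H1 : enorm (T X s - Xs j.+1 s) <= 2 * B / 2 ^+ j / 2 * w s.
    apply: (contract X (Xs j)) => //.
      by rewrite divr_ge0 ?exprn_ge0// mulr_ge0.
    move=> r rb; have /andP[tr _] := rb; rewrite XL//.
    rewrite (le_trans (HL r rb j))// ler_peMr ?w1//.
    by rewrite divr_ge0 ?exprn_ge0// mulr_ge0.
  have H2 : enorm (Xs j.+1 s - X s) <= B / 2 ^+ j.
    rewrite enormB XL// (le_trans (HL s sb j.+1))// exprS invfM.
    by rewrite le_eqVlt; apply/orP; left; apply/eqP; field; rewrite gt_eqF ?exprn_gt0.
  rewrite (le_trans (lerD H1 H2))// [leRHS]mulrDl lerD2r.
  rewrite (_ : 2 * B / 2 ^+ j / 2 * w s = B / 2 ^+ j * w s); last first.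
    by field; rewrite gt_eqF ?exprn_gt0.
  rewrite mulrAC ler_wpM2r ?invr_ge0 ?exprn_ge0//.
  apply: ler_pM => //; [exact: ltW|by rewrite ler_peMl// ler1n|exact: ww].
exists (T X); split => //.
- by apply: (@lipschitz_on_ac _ _ M); exact: lipschitz_onS lY.
- apply: aeS dY => s + /andP[ts s1].
  rewrite (le_lt_trans t0 ts) s1 => /(_ isT).
  by rewrite YX// (ltW ts) (ltW s1).
Qed.

(** The equation of [is_trajectory] on an arbitrary interval, which is what
    restriction and concatenation of trajectories require. *)
Definition solution a b u v X := absolutely_continuous_on a b X /\
  {ae mu, forall s : R, a < s < b ->
    is_derive s (1 : R) X (f s (X s) (u s) (v s))}.

Lemma solutionS a b a' b' u v X : a <= a' -> b' <= b ->
  solution a b u v X -> solution a' b' u v X.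
Proof.
move=> aa bb [acX dX]; split; first exact: absolutely_continuousS acX.
apply: aeS dX => s + /andP[as_ sb].
by rewrite (le_lt_trans aa as_) (lt_le_trans sb bb) => /(_ isT).
Qed.

Lemma solution_ae a b u v u' v' X : eq_ae_on a b u u' -> eq_ae_on a b v v' ->
  solution a b u v X -> solution a b u' v' X.
Proof.
move=> uu vv [acX dX]; split => //.
apply: aeS (ae_and (ae_and uu vv) dX) => s [[us vs] +] sab => /(_ sab).
have {}sab : `[a, b]%classic s.
  by rewrite /= in_itv/=; case/andP: sab => /ltW -> /ltW ->.
by rewrite us// vs.
Qed.

Section OnInterval.
Variables (a b : R) (u : R -> 'rV[R]_k) (v : R -> 'rV[R]_l).
Hypotheses (a0 : 0 <= a) (ab : a <= b) (b1 : b <= 1).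
Hypotheses (cu : controls U u) (cv : controls V v).

Let in01 s : a < s < b -> 0 <= s <= 1.
Proof.
move=> /andP[as_ sb].
by rewrite (le_trans a0 (ltW as_)) (le_trans (ltW sb) b1).
Qed.

Lemma solution_lipschitz X : solution a b u v X -> lipschitz_on M a b X.
Proof.
move=> [acX dX]; apply: derivative_bound_lipschitz => //.
apply: aeS dX => s + sab => /(_ sab) dXs.
exists (f s (X s) (u s) (v s)) => //; have s01 := in01 sab.
by apply: (bound_dyn reg) => //; [exact: cu.1|exact: cv.1].
Qed.

(** The factor of Gronwall's inequality on an interval of length at most 1. *)
Definition stability_constant := 2 * expR (2 * c).

Lemma solution_stable X Y : solution a b u v X -> solution a b u v Y ->
  enorm (X b - Y b) <= stability_constant * enorm (X a - Y a).
Proof.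
move=> sX sY; have lX := solution_lipschitz sX; have lY := solution_lipschitz sY.
apply: (@le_trans _ _ (2 * expR (2 * c * (b - a)) * enorm (X a - Y a))).
  apply: (@gronwall _ _ (fun s => X s - Y s) _ _ _ (M + M)) => //.
    move=> s r as_ sr rb; rewrite subrACA (le_trans (enormD _ _))// enormN.
    by rewrite mulrDl lerD ?lX ?lY.
  apply: aeS (ae_and sX.2 sY.2) => s [dX dY] sab.
  exists (f s (X s) (u s) (v s) - f s (Y s) (u s) (v s)).
    by apply: is_deriveB; [exact: dX|exact: dY].
  have s01 := in01 sab.
  have := lip_dyn reg (X s) (Y s) s01 s01 (cu.1 _ s01) (cv.1 _ s01).
  by rewrite subrr normr0 add0r.
rewrite ler_wpM2r ?enorm_ge0// ler_pM2l// ler_expR.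
by rewrite -[leRHS]mulr1 ler_wpM2l ?mulr_ge0//; move: a0 b1; lra.
Qed.

End OnInterval.

Lemma stability_constant_ge0 : 0 <= stability_constant.
Proof. by rewrite mulr_ge0// expR_ge0. Qed.

Lemma trajectoryP t x u v : 0 <= t <= 1 -> controls U u -> controls V v ->
  trajectory f t x u v t = x /\ solution t 1 u v (trajectory f t x u v).
Proof.
move=> t01 cu cv; have := getPex (trajectory_exists x t01 cu cv).
by rewrite -/(trajectory _ _ _ _ _) => -[].
Qed.

Lemma trajectory_start t x u v : 0 <= t <= 1 -> controls U u -> controls V v ->
  trajectory f t x u v t = x.
Proof. by move=> t01 cu cv; case: (trajectoryP x t01 cu cv). Qed.

Lemma trajectory_lipschitz t x u v : 0 <= t <= 1 -> controls U u ->
  controls V v -> lipschitz_on M t 1 (trajectory f t x u v).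
Proof.
move=> t01 cu cv; have [_ sX] := trajectoryP x t01 cu cv.
by case/andP: t01 => t0 t1; apply: solution_lipschitz sX.
Qed.

Lemma trajectory_unique t s x u v X : 0 <= t -> t <= s -> s <= 1 ->
  controls U u -> controls V v -> solution t s u v X -> X t = x ->
  trajectory f t x u v s = X s.
Proof.
move=> t0 ts s1 cu cv sX Xt.
have t01 : 0 <= t <= 1 by rewrite t0 (le_trans ts).
have [Tt /(solutionS (lexx t) s1) sT] := trajectoryP x t01 cu cv.
apply/eqP; rewrite -subr_eq0; apply/eqP; apply: enorm_eq0; apply/eqP.
rewrite eq_le enorm_ge0 andbT.
rewrite (le_trans (solution_stable t0 ts s1 cu cv sT sX))//.
by rewrite Tt Xt subrr enorm0 mulr0.
Qed.

Lemma trajectory_ae t s x u v u' v' : 0 <= t -> t <= s -> s <= 1 ->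
  controls U u -> controls V v -> controls U u' -> controls V v' ->
  eq_ae_on t s u u' -> eq_ae_on t s v v' ->
  trajectory f t x u v s = trajectory f t x u' v' s.
Proof.
move=> t0 ts s1 cu cv cu' cv' uu vv.
have t01 : 0 <= t <= 1 by rewrite t0 (le_trans ts).
have [Tt /(solutionS (lexx t) s1) sT] := trajectoryP x t01 cu cv.
by apply/esym/trajectory_unique => //; exact: solution_ae sT.
Qed.

Lemma trajectory_flow t r s x u v : 0 <= t -> t <= r -> r <= s -> s <= 1 ->
  controls U u -> controls V v ->
  trajectory f r (trajectory f t x u v r) u v s = trajectory f t x u v s.
Proof.
move=> t0 tr rs s1 cu cv.
have t01 : 0 <= t <= 1 by rewrite t0 (le_trans tr)// (le_trans rs).
have [Tt /(solutionS tr s1) sT] := trajectoryP x t01 cu cv.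
by apply: trajectory_unique => //; exact: le_trans tr.
Qed.

Lemma trajectory_stable t s x y u v : 0 <= t -> t <= s -> s <= 1 ->
  controls U u -> controls V v ->
  enorm (trajectory f t x u v s - trajectory f t y u v s) <=
  stability_constant * enorm (x - y).
Proof.
move=> t0 ts s1 cu cv.
have t01 : 0 <= t <= 1 by rewrite t0 (le_trans ts).
have [xt /(solutionS (lexx t) s1) sx] := trajectoryP x t01 cu cv.
have [yt /(solutionS (lexx t) s1) sy] := trajectoryP y t01 cu cv.
by have := solution_stable t0 ts s1 cu cv sx sy; rewrite xt yt.
Qed.

Lemma trajectory_dist t s x u v : 0 <= t -> t <= s -> s <= 1 ->
  controls U u -> controls V v -> enorm (trajectory f t x u v s - x) <= M * (s - t).
Proof.
move=> t0 ts s1 cu cv.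
have t01 : 0 <= t <= 1 by rewrite t0 (le_trans ts).
by have := trajectory_lipschitz x t01 cu cv (lexx t) ts s1;
  rewrite trajectory_start.
Qed.

End Trajectories.

(** * Strategies with delay *)

Section AlmostEverywhere.
Context {R : realType} {m : nat}.
Implicit Types (a b : R) (u v w : R -> 'rV[R]_m).
Local Notation mu := (@lebesgue_measure R).

Lemma eq_ae_on_refl a b u : eq_ae_on a b u u.
Proof. by apply: aeW. Qed.

Lemma eq_ae_on_sym a b u v : eq_ae_on a b u v -> eq_ae_on a b v u.
Proof. by apply: aeS => s uv sab; rewrite uv. Qed.

Lemma eq_ae_on_trans a b u v w : eq_ae_on a b u v -> eq_ae_on a b v w ->
  eq_ae_on a b u w.
Proof. by move=> uv vw; apply: aeS (ae_and uv vw) => s [H1 H2] sab; rewrite H1// H2. Qed.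

Lemma eq_ae_onS a b a' b' u v : a <= a' -> b' <= b -> eq_ae_on a b u v ->
  eq_ae_on a' b' u v.
Proof.
move=> aa bb; apply: aeS => s uv; rewrite /= in_itv/= => /andP[as_ sb].
by apply: uv; rewrite /= in_itv/= (le_trans aa)// (le_trans sb).
Qed.

Lemma eq_ae_on_pt a u v : eq_ae_on a a u v.
Proof.
apply: negligibleS (negligible_set1 a) => s /= H; apply: contrapT => sa.
by apply: H; rewrite in_itv/= => /le_anti as_; case: sa.
Qed.

Lemma eq_on_eq_ae_on a b u v : (forall s, a <= s < b -> u s = v s) ->
  eq_ae_on a b u v.
Proof.
move=> uv; apply: negligibleS (negligible_set1 b) => s /= H.
apply: contrapT => sb; apply: H; rewrite in_itv/= => /andP[as_ sb'].
by apply: uv; rewrite as_ lt_neqAle sb' andbT; apply/eqP.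
Qed.

Lemma controls_cst (A : set 'rV[R]_m) z : A z -> controls A (cst z).
Proof. by move=> Az; split => //; exact: measurable_cst. Qed.

Lemma controls_glue (A : set 'rV[R]_m) u v r : controls A u -> controls A v ->
  controls A (fun s => if s < r then u s else v s).
Proof.
move=> [Au mu_] [Av mv]; split => [t t01|].
  by case: ifP => _; [exact: Au|exact: Av].
move=> mD B mB.
have mI (I : set R) : measurable I -> measurable (I : set (lebesgueType R)).
  exact: borel_lebesgue_measurable.
rewrite (_ : _ `&` _ =
    ((`[0, 1]%classic `&` u @^-1` B) `&` `]-oo, r[%classic) `|`
    ((`[0, 1]%classic `&` v @^-1` B) `&` `[r, +oo[%classic)).
  apply: (@measurableU _ (lebesgueType R)); apply: (@measurableI _ (lebesgueType R)).
  - exact: mu_.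
  - exact: mI.
  - exact: mv.
  - exact: mI.
apply/seteqP; split => s /=; rewrite !in_itv/= andbT.
- by case: ltP => sr [s01 Bs]; [left|right].
- by case=> -[[s01 Bs]]; [move=> ->|rewrite ltNge => ->].
Qed.

End AlmostEverywhere.

Section Partitions.
Context {R : realType}.
Implicit Types (a t r : R) (s P : seq R).

Lemma path_locate d a s r : path <%O a s -> a <= r -> r < last a s ->
  exists2 m, (m < size s)%N & nth d (a :: s) m <= r < nth d (a :: s) m.+1.
Proof.
elim: s a => [|x s IH] a /=; first by move=> _ ar; rewrite ltNge ar.
move=> /andP[ax xs] ar rl; have [rx|xr] := ltP r x.
  by exists 0%N => //=; rewrite ar.
by have [m ms H] := IH x xs xr rl; exists m.+1.
Qed.

Lemma grid_bounds a s m : itv_partition a 1 s -> (m < size s)%N ->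
  [/\ a <= grid a s m, grid a s m < grid a s m.+1 & grid a s m.+1 <= 1].
Proof.
move=> ps ms; have := ps => -[pt _]; rewrite /grid; split.
- rewrite (set_nth_default 1) ?ltnS ?(ltnW ms)//.
  by apply: itv_partition_nth_ge => //; rewrite ltnS ltnW.
- by have /(pathP a)/(_ m ms) := pt.
- rewrite (set_nth_default 1) ?ltnS//.
  by apply: itv_partition_nth_le.
Qed.

Lemma grid_last a s : itv_partition a 1 s -> grid a s (size s) = 1.
Proof. by move=> [_ /eqP <-]; rewrite /grid nth_last. Qed.

Definition avoids P r t := forall p, p \in P -> ~~ (r < p < t).

(** Refinement by P: the points of P inside ]t, 1[, in increasing order, and 1. *)
Lemma partition_avoiding P t : t <= 1 -> exists2 s, itv_partition t 1 s &
  forall m, (m < size s)%N -> avoids P (grid t s m) (grid t s m.+1).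
Proof.
rewrite le_eqVlt => /predU1P[->|t1]; first by exists [::].
pose s0 := sort <=%O (undup [seq p <- P | t < p < 1]).
have ms0 p : (p \in s0) = (t < p < 1) && (p \in P).
  by rewrite mem_sort mem_undup mem_filter.
have srt : sorted <%O s0 by rewrite sort_lt_sorted undup_uniq.
have ps : path <%O t (rcons s0 1).
  rewrite rcons_path lt_path_sortedE srt andbT; apply/andP; split.
    by apply/allP => p; rewrite ms0 => /andP[/andP[]].
  have := mem_last t s0; rewrite inE => /predU1P[->//|].
  by rewrite ms0 => /andP[/andP[]].
have its : itv_partition t 1 (rcons s0 1) by split => //; rewrite last_rcons.
exists (rcons s0 1) => // m ms p pP; apply/negP => /andP[mp pm].
have [tm _ m1] := grid_bounds its ms.
have : p \in t :: rcons s0 1.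
  by rewrite inE mem_rcons inE ms0 pP (le_lt_trans tm mp) (lt_le_trans pm m1) !orbT.
move=> /(nthP t)[j js pE]; move: mp pm; rewrite /grid -pE.
have smono := @lt_sorted_ltn_nth _ _ t (t :: rcons s0 1) ps.
rewrite !smono ?inE//=; last by rewrite ltnS ltnW.
by move=> mj; rewrite ltnS leqNgt mj.
Qed.

Lemma previous_avoiding P t r : t < r -> exists2 q, t <= q < r & avoids P q r.
Proof.
move=> tr; elim: P => [|p P [q /andP[tq qr] H]]; first by exists t; rewrite ?lexx.
have [/andP[qp pr]|npr] := boolP (q < p < r).
  exists p; first by rewrite pr (le_trans tq)// ltW.
  move=> y; rewrite inE => /predU1P[->|yP]; first by rewrite ltxx.
  by apply: contra (H y yP) => /andP[py ->]; rewrite (lt_trans qp py).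
exists q; first by rewrite tq.
by move=> y; rewrite inE => /predU1P[->//|]; exact: H.
Qed.

End Partitions.

Section Strategies.
Context {R : realType} {i j : nat}.
Variables (A : set 'rV[R]_i) (B : set 'rV[R]_j).
Implicit Types (b : (R -> 'rV[R]_i) -> (R -> 'rV[R]_j)) (P : seq R).

(** A form of the delay condition that is monotone in P: strategies with
    different partitions can be compared on a common refinement. *)
Definition delayed (t0 : R) P b := forall r r' u1 u2, t0 <= r -> r < r' ->
  r' <= 1 -> avoids P r r' -> controls A u1 -> controls A u2 ->
  eq_ae_on t0 r u1 u2 -> eq_ae_on t0 r' (b u1) (b u2).

Lemma delayedS t0 P Q b : {subset P <= Q} -> delayed t0 P b -> delayed t0 Q b.
Proof.
move=> PQ dP r r' u1 u2 tr rr r1 av; apply: dP => //.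
by move=> p pP; apply: av; exact: PQ.
Qed.

Lemma strategy_delayed t0 b : strategies A B t0 b -> exists P, delayed t0 P b.
Proof.
move=> [_ [s ps H]]; exists s => r r' u1 u2 tr rr r1 av c1 c2 uu.
have [pt /eqP l1] := ps.
have [|m ms /andP[mr rm]] := path_locate t0 pt tr; first by rewrite l1 (lt_le_trans rr).
have r'm : r' <= nth t0 (t0 :: s) m.+1.
  have := av (nth t0 s m) (mem_nth _ ms).
  by rewrite rm/= -leNgt.
apply: eq_ae_onS (lexx _) r'm _; apply: (H _ _ m) => //.
exact: eq_ae_onS (lexx _) mr uu.
Qed.

Lemma delayed_strategy t0 P b : t0 <= 1 ->
  (forall u, controls A u -> controls B (b u)) -> delayed t0 P b ->
  strategies A B t0 b.
Proof.
move=> t1 cb dP; split => //.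
have [s ps av] := partition_avoiding P t1; exists s => // u1 u2 m c1 c2 ms uu.
have [tm mm m1] := grid_bounds ps ms.
by apply: dP uu => //; exact: av.
Qed.

(** Strategies are nonanticipative: go back to a time q < r after which no
    partition point precedes r. *)
Lemma delayed_causal t0 P b r u1 u2 : delayed t0 P b -> t0 <= r -> r <= 1 ->
  controls A u1 -> controls A u2 -> eq_ae_on t0 r u1 u2 ->
  eq_ae_on t0 r (b u1) (b u2).
Proof.
move=> dP; rewrite le_eqVlt => /predU1P[->|t0r] r1 c1 c2 uu.
  exact: eq_ae_on_pt.
have [q /andP[tq qr] av] := previous_avoiding P t0r.
by apply: (dP q r) => //; exact: eq_ae_onS (lexx _) (ltW qr) uu.
Qed.

Lemma cst_strategy t0 v : t0 <= 1 -> controls B v -> strategies A B t0 (cst v).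
Proof.
move=> t1 cv; apply: (@delayed_strategy _ [::]) => //.
by move=> *; exact: eq_ae_on_refl.
Qed.

End Strategies.

Section Play.
Context {R : realType} {k l : nat}.
Variables (U : set 'rV[R]_k) (V : set 'rV[R]_l).
Hypotheses (U0 : U !=set0) (V0 : V !=set0).

(** Iterating (u, v) |-> (a v, b u) determines the play on one more interval
    of a common partition at each step. *)
Lemma play_exists t0 a b : t0 <= 1 -> strategies1 U V t0 a ->
  strategies2 U V t0 b ->
  exists w, [/\ controls U w.1, controls V w.2,
    eq_ae_on t0 1 (a w.2) w.1 & eq_ae_on t0 1 (b w.1) w.2].
Proof.
move=> t1 sa sb; have [u0 Uu0] := U0; have [v0 Vv0] := V0.
have [P dP] := strategy_delayed sa; have [Q dQ] := strategy_delayed sb.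
have {}dP := @delayedS _ _ _ _ _ P (P ++ Q) _ _ dP.
have {}dQ := @delayedS _ _ _ _ _ Q (P ++ Q) _ _ dQ.
have {}dP := dP ltac:(by move=> p pP; rewrite mem_cat pP).
have {}dQ := dQ ltac:(by move=> p pP; rewrite mem_cat pP orbT).
have [s ps av] := partition_avoiding (P ++ Q) t1.
pose w m := iter m (fun w => (a w.2, b w.1)) (cst u0, cst v0).
have cw m : controls U (w m).1 /\ controls V (w m).2.
  elim: m => [|m [IH1 IH2]]; first by split; exact: controls_cst.
  by split; [exact: sa.1|exact: sb.1].
have eqw m : (m <= size s)%N ->
    eq_ae_on t0 (grid t0 s m) (w m.+1).1 (w m).1 /\
    eq_ae_on t0 (grid t0 s m) (w m.+1).2 (w m).2.
  elim: m => [_|m IH ms]; first by split; exact: eq_ae_on_pt.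
  have [IH1 IH2] := IH (ltnW ms).
  have [tm mm m1] := grid_bounds ps ms.
  split.
  - by apply: dP IH2 => //; [exact: av|exact: (cw _).2|exact: (cw _).2].
  - by apply: dQ IH1 => //; [exact: av|exact: (cw _).1|exact: (cw _).1].
exists (w (size s)); have [cu cv] := cw (size s).
by have := eqw _ (leqnn _); rewrite grid_last// => -[].
Qed.

Lemma playP t0 a b : t0 <= 1 -> strategies1 U V t0 a -> strategies2 U V t0 b ->
  let w := play U V t0 a b in [/\ controls U w.1, controls V w.2,
    eq_ae_on t0 1 (a w.2) w.1 & eq_ae_on t0 1 (b w.1) w.2].
Proof. by move=> t1 sa sb; exact: (getPex (play_exists t1 sa sb)). Qed.

Context {n : nat}.
Variable f : R -> 'rV[R]_n -> 'rV[R]_k -> 'rV[R]_l -> 'rV[R]_n.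
Variable g : 'rV[R]_n -> R.
Variables (M c : R).
Hypothesis reg : regular_dynamics U V f M c.

Definition payoff t0 x0 u v := g (trajectory f t0 x0 u v 1).

Lemma payoff_ae t0 x0 u v u' v' : 0 <= t0 <= 1 ->
  controls U u -> controls V v -> controls U u' -> controls V v' ->
  eq_ae_on t0 1 u u' -> eq_ae_on t0 1 v v' ->
  payoff t0 x0 u v = payoff t0 x0 u' v'.
Proof.
move=> /andP[t0ge t1] cu cv cu' cv' uu vv; congr g.
exact: (trajectory_ae reg).
Qed.

Lemma outcome_payoff1 t0 x0 a b : 0 <= t0 <= 1 -> strategies1 U V t0 a ->
  strategies2 U V t0 b -> exists2 v, controls V v &
  outcome U V f g t0 x0 a b = payoff t0 x0 (a v) v.
Proof.
move=> t01 sa sb; have /andP[_ t1] := t01.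
have /= [cu cv ua vb] := playP t1 sa sb.
exists (play U V t0 a b).2 => //; rewrite /outcome -/(payoff _ _ _ _).
by apply: payoff_ae => //; [exact: sa.1|exact: eq_ae_on_sym|exact: eq_ae_on_refl].
Qed.

Lemma outcome_payoff2 t0 x0 a b : 0 <= t0 <= 1 -> strategies1 U V t0 a ->
  strategies2 U V t0 b -> exists2 u, controls U u &
  outcome U V f g t0 x0 a b = payoff t0 x0 u (b u).
Proof.
move=> t01 sa sb; have /andP[_ t1] := t01.
have /= [cu cv ua vb] := playP t1 sa sb.
exists (play U V t0 a b).1 => //; rewrite /outcome -/(payoff _ _ _ _).
by apply: payoff_ae => //; [exact: sb.1|exact: eq_ae_on_refl|exact: eq_ae_on_sym].
Qed.

(** A constant strategy of player 2 forces its control, so that the play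
    follows the answer of a to it. *)
Lemma outcome_cst t0 x0 a v : 0 <= t0 <= 1 -> strategies1 U V t0 a ->
  controls V v -> outcome U V f g t0 x0 a (cst v) = payoff t0 x0 (a v) v.
Proof.
move=> t01 sa cv; have /andP[_ t1] := t01.
have /= [cu cv' ua vb] := playP t1 sa (cst_strategy U t1 cv).
rewrite /outcome -/(payoff _ _ _ _).
apply: payoff_ae => //; [exact: sa.1| |exact: eq_ae_on_sym].
apply: eq_ae_on_trans (eq_ae_on_sym ua) _.
have [P dP] := strategy_delayed sa.
by apply: (delayed_causal dP) => //; exact: eq_ae_on_sym.
Qed.

(** A play against a is the answer of a to a single control of player 2, and
    constant strategies realize all of them. *)
Lemma inf_outcome t0 x0 a : 0 <= t0 <= 1 -> strategies1 U V t0 a ->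
  [set (outcome U V f g t0 x0 a b)%:E | b in strategies2 U V t0] =
  [set (payoff t0 x0 (a v) v)%:E | v in controls V].
Proof.
move=> t01 sa; have /andP[_ t1] := t01.
apply/seteqP; split.
- by move=> _ [b sb <-]; have [v cv ->] := outcome_payoff1 x0 t01 sa sb; exists v.
- move=> _ [v cv <-]; exists (cst v); first exact: cst_strategy.
  by rewrite outcome_cst.
Qed.

Hypothesis g_lip : exists2 K : R, 0 <= K &
  forall x y, `|g x - g y| <= K * enorm (x - y).

Lemma payoff_bounded t0 x0 : 0 <= t0 <= 1 -> exists C : R,
  forall u v, controls U u -> controls V v -> `|payoff t0 x0 u v| <= C.
Proof.
move=> /andP[t0ge t1]; have [K K0 gK] := g_lip.
exists (`|g x0| + K * (M * (1 - t0))) => u v cu cv.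
rewrite -[payoff _ _ _ _](subrK (g x0)) (le_trans (ler_normD _ _))// addrC lerD2l.
rewrite (le_trans (gK _ _))// ler_wpM2l//.
exact: (trajectory_dist reg).
Qed.

Local Notation val := (value U V f g).

Lemma lower_value_fin t0 x0 : 0 <= t0 <= 1 ->
  lower_value U V f g t0 x0 = (val t0 x0)%:E.
Proof.
move=> t01; have /andP[_ t1] := t01; have [C HC] := payoff_bounded x0 t01.
have [u0 Uu0] := U0; have [v0 Vv0] := V0.
have cu0 := controls_cst Uu0; have cv0 := controls_cst Vv0.
rewrite /value fineK// fin_numE; apply/andP; split.
- rewrite -ltNye (@lt_le_trans _ _ (- C)%:E) ?ltNyr//.
  have s0 : strategies1 U V t0 (cst (cst u0)) by exact: cst_strategy.
  apply: le_trans (ereal_sup_ubound _); last by exists (cst (cst u0)).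
  rewrite inf_outcome//; apply: le_ereal_inf_tmp => _ [v cv <-].
  by rewrite lee_fin; have := HC _ _ cu0 cv; rewrite ler_norml => /andP[].
- rewrite -ltey (@le_lt_trans _ _ C%:E) ?ltry//.
  apply: ge_ereal_sup => _ [a sa <-]; rewrite inf_outcome//.
  apply: le_trans (ereal_inf_lbound _) _; first by exists (cst v0).
  by rewrite lee_fin; have := HC _ _ (sa.1 _ cv0) cv0; rewrite ler_norml => /andP[].
Qed.

Lemma value_ge t0 x0 a y : 0 <= t0 <= 1 -> strategies1 U V t0 a ->
  (forall v, controls V v -> y <= payoff t0 x0 (a v) v) -> y <= val t0 x0.
Proof.
move=> t01 sa H; rewrite -lee_fin -lower_value_fin//.
apply: le_trans (ereal_sup_ubound _); last by exists a.
rewrite inf_outcome//; apply: le_ereal_inf_tmp => _ [v cv <-].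
by rewrite lee_fin H.
Qed.

Lemma value_approx t0 x0 e : 0 <= t0 <= 1 -> 0 < e ->
  exists2 a, strategies1 U V t0 a &
    forall v, controls V v -> val t0 x0 - e <= payoff t0 x0 (a v) v.
Proof.
move=> t01 e0.
have : ((val t0 x0 - e)%:E < lower_value U V f g t0 x0)%E.
  by rewrite lower_value_fin// lte_fin; lra.
move=> /ereal_sup_gt[_ [a sa <-]]; rewrite inf_outcome// => H.
exists a => // v cv; rewrite -lee_fin (le_trans (ltW H))//.
by apply: ereal_inf_lbound; exists v.
Qed.

Lemma lower_le_upper t0 x0 : 
  (lower_value U V f g t0 x0 <= upper_value U V f g t0 x0)%E.
Proof.
apply: ge_ereal_sup => _ [a sa <-]; apply: le_ereal_inf_tmp => _ [b sb <-].
apply: (@le_trans _ _ (outcome U V f g t0 x0 a b)%:E).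
  by apply: ereal_inf_lbound; exists b.
by apply: ereal_sup_ubound; exists a.
Qed.

End Play.

(** * Extremal aiming *)

Section LowerSemicontinuity.
Context {R : realType} {n : nat}.
Implicit Types (x w : 'rV[R]_n) (phi : 'rV[R]_n -> R).

Lemma bounded_seq_cluster (y : nat -> 'rV[R]_n) w (C : R) :
  (forall j, enorm (y j - w) <= C) ->
  exists p : 'rV[R]_n, forall N : set 'rV[R]_n, nbhs p N ->
    forall J, exists2 j, (J <= j)%N & N (y j).
Proof.
move=> yC; pose r := `|C| + 1.
have r0 : 0 < r by rewrite ltr_wpDl.
have cB : compact (closed_ball w r).
  apply: bounded_closed_compact; last exact: closed_ball_closed.
  exists (`|w| + r); split; first by rewrite num_real.
  move=> z rz x; rewrite closed_ballE// /closed_ball_/= => xw.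
  rewrite -(subrK w x) (le_trans (ler_normD _ _))//.
  by rewrite addrC (le_trans _ (ltW rz))// lerD2l distrC.
have yB : (y @ \oo) (closed_ball w r).
  exists 0%N => // j _ /=; rewrite closed_ballE// /closed_ball_/=.
  rewrite distrC (le_trans (mx_norm_le_enorm _))// (le_trans (yC j))//.
  by rewrite (le_trans (ler_norm C))// lerDl.
have [p [_ clp]] := cB _ _ yB; exists p => N Np J.
have [|z [[j /= Jj <-] Nz]] := clp [set y j | j in [set j | (J <= j)%N]] N _ Np.
  by exists J => // j Jj; exists j.
by exists j.
Qed.

(** Cluster points keep the bounds satisfied asymptotically by a sequence:
    this replaces the attainment of an infimum. *)
Lemma lsc_limit phi (y : nat -> 'rV[R]_n) w (C r : R) :
  lower_semicontinuous (fun x => (phi x)%:E) ->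
  (forall j, enorm (y j - w) <= C) ->
  (forall j, phi (y j) <= r + 1 / 2 ^+ j) ->
  exists2 p, phi p <= r &
    forall x B, (forall j, enorm (x - y j) <= B + 1 / 2 ^+ j) ->
      enorm (x - p) <= B.
Proof.
move=> lsc yC yr; have [p clp] := bounded_seq_cluster yC.
have small (e : R) : 0 < e -> exists J, forall j, (J <= j)%N -> 1 / 2 ^+ j < e.
  move=> e0; have [J HJ] := geometric_lt 1 e0; exists J => j Jj.
  apply: le_lt_trans HJ; rewrite ler_wpM2l// lef_pV2 ?posrE ?exprn_gt0//.
  by rewrite ler_eXn2l// ltr1n.
exists p.
- rewrite leNgt; apply/negP => rp.
  pose a := (r + phi p) / 2.
  have [|N Np Na] := lsc p a; first by rewrite lte_fin /a; lra.
  have [|J HJ] := small (a - r); first by rewrite /a; lra.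
  have [j Jj /Na] := clp N Np J; rewrite lte_fin => aj.
  have := HJ j Jj; have := yr j; move: aj; lra.
- move=> x B xy; apply/ler_addgt0Pl => e e0.
  have e1 : 0 < e / 2 / n.+1%:R by rewrite !divr_gt0.
  have [|J HJ] := small (e / 2); first by rewrite divr_gt0.
  have [j Jj] := clp _ (nbhsx_ballx p _ e1) J.
  rewrite -ball_normE/= => pj.
  rewrite (le_trans (enorm_triangle (y j) _ _))//.
  have : enorm (y j - p) <= e / 2.
    rewrite enormB (le_trans (enorm_le_mx_norm _))// mulrC -ler_pdivlMr//.
    exact: ltW.
  have := xy j; have := HJ j Jj; lra.
Qed.

(** Take the cluster point of a minimizing sequence of the distance to x. *)
Lemma closest_point phi (r : R) x w :
  lower_semicontinuous (fun x => (phi x)%:E) -> phi w <= r ->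
  exists2 p, phi p <= r & forall y, phi y <= r -> enorm (x - p) <= enorm (x - y).
Proof.
move=> lsc wr.
pose D := [set enorm (x - y) | y in [set y | phi y <= r]].
have hD : has_inf D.
  by split; [exists (enorm (x - w)), w|exists 0 => _ [y _ <-]; exact: enorm_ge0].
have /choice[y Hy] : forall j : nat, exists y, phi y <= r /\
    enorm (x - y) <= inf D + 1 / 2 ^+ j.
  move=> j; have j0 : 0 < 1 / 2 ^+ j :> R by rewrite divr_gt0// exprn_gt0.
  by have [_ [y /= yr <-] /ltW yD] := inf_adherent j0 hD; exists y.
have [j|j|p pr Hp] := @lsc_limit phi y x (inf D + 1) r lsc.
- rewrite enormB (le_trans (Hy j).2)// lerD2l ler_pdivrMr ?exprn_gt0// mul1r.
  by rewrite exprn_ege1// ler1n.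
- by rewrite (le_trans (Hy j).1)// lerDl divr_ge0// exprn_ge0.
exists p => // z zr; apply: le_trans (Hp x (inf D) (fun j => (Hy j).2)) _.
by apply: ge_inf; [exact: hD.2|exists z].
Qed.

End LowerSemicontinuity.

Section OneStep.
Context {R : realType} {n k l : nat}.
Variables (U : set 'rV[R]_k) (V : set 'rV[R]_l).
Variable f : R -> 'rV[R]_n -> 'rV[R]_k -> 'rV[R]_l -> 'rV[R]_n.
Variables (M c : R).
Hypothesis reg : regular_dynamics U V f M c.
Implicit Types (X Y : R -> 'rV[R]_n) (u : R -> 'rV[R]_k) (v : R -> 'rV[R]_l).

(** Existence of the value makes an optimal action of the minimizer part of a
    saddle point. *)
Lemma saddle_inequality (S T : Type) (A : set S) (B : set T) (p : S -> T -> R) b :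
  has_value A B p -> optimal_min A B p b ->
  exists2 a, A a & forall a' b', A a' -> B b' -> p a' b <= p a b'.
Proof.
move=> [_ _ [a Aa aE] _ vE] [Bb bE]; exists a => // a' b' Aa' Bb'.
rewrite -lee_fin; apply: (@le_trans _ _ (max_payoff A p b)).
  by apply: ereal_sup_ubound; exists a'.
by rewrite bE -vE -aE; apply: ereal_inf_lbound; exists b'.
Qed.

(** Collects, over a step of length h <= 1: the Lipschitz dependence on the
    position (2 c), the variation of f along the step (2 c (1 + M)), and the
    square of the relative displacement, at most 2 M h (4 M^2). *)
Definition aiming_constant := 2 * c + 2 * c * (1 + M) + 4 * M ^+ 2.

Let M0 : 0 <= M. Proof. by case: reg. Qed.
Let c0 : 0 <= c. Proof. by case: reg. Qed.

Lemma aiming_constant_ge0 : 0 <= aiming_constant.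
Proof. by rewrite /aiming_constant !addr_ge0 ?mulr_ge0 ?addr_ge0 ?sqr_ge0. Qed.

(** Let X follow (u, b) from x and W follow (a, v) from w, where (a, b) is a
    saddle point for the direction x - w.  Up to the variations of f over
    the step, X - W does not grow along x - w, so that |X - W|^2 increases
    at most by a factor 1 + C h and a term of second order in h. *)
Lemma aiming_step t t' x w u v a b X W : 0 <= t -> t <= t' -> t' <= 1 ->
  controls U u -> controls V v -> U a -> V b ->
  (forall a' b', U a' -> V b' ->
     dotp (x - w) (f t x a' b) <= dotp (x - w) (f t x a b')) ->
  solution f t t' u (cst b) X -> X t = x ->
  solution f t t' (cst a) v W -> W t = w ->
  enorm (X t' - W t') ^+ 2 <=
    (1 + aiming_constant * (t' - t)) * enorm (x - w) ^+ 2 +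
    aiming_constant * (t' - t) ^+ 2.
Proof.
move=> t0 tt t1 cu cv Ua Vb saddle sX Xt sW Wt.
have ca := controls_cst Ua; have cb := controls_cst Vb.
have lX := solution_lipschitz reg t0 t1 cu cb sX.
have lW := solution_lipschitz reg t0 t1 ca cv sW.
set h := t' - t; set e := enorm (x - w).
have h0 : 0 <= h by rewrite subr_ge0.
have h1 : h <= 1 by rewrite /h; lra.
have e0 : 0 <= e := enorm_ge0 _.
pose A := e * (2 * c * (1 + M) * h + c * e).
have M1 : 0 <= 1 + M by rewrite addr_ge0.
have A0 : 0 <= A.
  apply: mulr_ge0 => //; apply: addr_ge0; last exact: mulr_ge0.
  by rewrite !mulr_ge0.
have acXW : absolutely_continuous_on t t' (fun s => X s - W s).
  by apply: absolutely_continuousB; [case: sX|case: sW].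
have dXW : dotp (x - w) (X t' - W t' - (x - w)) <= A * h.
  have := @dotp_increment_le _ _ (fun s => X s - W s) (fun s => A * s) t t' (x - w).
  rewrite Xt Wt -mulrBr; apply => //.
    apply: (@abs_cont_lipschitz _ _ _ _ A) => s r _ sr _.
    by rewrite -mulrBr normrM !ger0_norm// subr_ge0.
  apply: aeS (ae_and sX.2 sW.2) => s [dX dW] sab.
  exists (f s (X s) (u s) b - f s (W s) a (v s)), A.
    split; first by apply: is_deriveB; [exact: dX|exact: dW].
    have := @is_deriveZ _ _ _ (@id R) A s 1 1 (is_derive_id _ _).
    by rewrite /GRing.scale/= mulr1.
  have /andP[/ltW ts /ltW st'] := sab.
  have s01 : 0 <= s <= 1 by rewrite (le_trans t0) ?(le_trans st').
  have t01 : 0 <= t <= 1 by rewrite t0 (le_trans tt).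
  have sth : `|s - t| <= h by rewrite ger0_norm ?subr_ge0// lerD2r.
  have Xsx : enorm (X s - x) <= M * h.
    by rewrite -Xt (le_trans (lX _ _ (lexx _) ts st'))// ler_wpM2l// lerD2r.
  have Wsw : enorm (W s - w) <= M * h.
    by rewrite -Wt (le_trans (lW _ _ (lexx _) ts st'))// ler_wpM2l// lerD2r.
  have Wsx : enorm (W s - x) <= M * h + e.
    by rewrite (le_trans (enorm_triangle w _ _))// (enormB w) lerD2r.
  have H1 : enorm (f s (X s) (u s) b - f t x (u s) b) <= c * (h + M * h).
    apply: (le_trans (lip_dyn reg _ _ s01 t01 (cu.1 _ s01) Vb)).
    by rewrite ler_wpM2l// lerD.
  have H2 : enorm (f t x a (v s) - f s (W s) a (v s)) <= c * (h + (M * h + e)).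
    rewrite enormB; apply: (le_trans (lip_dyn reg _ _ s01 t01 Ua (cv.1 _ s01))).
    by rewrite ler_wpM2l// lerD.
  have -> : f s (X s) (u s) b - f s (W s) a (v s) =
      (f s (X s) (u s) b - f t x (u s) b) +
      ((f t x (u s) b - f t x a (v s)) + (f t x a (v s) - f s (W s) a (v s))).
    by rewrite subrKA subrKA.
  have := saddle _ _ (cu.1 _ s01) (cv.1 _ s01).
  have := le_trans (CauchySchwarz (x - w) _) (ler_wpM2l e0 H1).
  have := le_trans (CauchySchwarz (x - w) _) (ler_wpM2l e0 H2).
  rewrite !dotpDr !dotpNr -/e /A; lra.
have nXW : enorm (X t' - W t' - (x - w)) <= 2 * M * h.
  rewrite subrACA (le_trans (enormD _ _))// enormN -Xt -Wt.
  have := lX _ _ (lexx _) tt (lexx _); have := lW _ _ (lexx _) tt (lexx _).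
  rewrite -/h; lra.
have nXW2 : enorm (X t' - W t' - (x - w)) ^+ 2 <= (2 * M * h) ^+ 2.
  by rewrite ler_pXn2r// nnegrE ?enorm_ge0// !mulr_ge0.
have -> : X t' - W t' = (x - w) + (X t' - W t' - (x - w)).
  by rewrite [RHS]addrC subrK.
rewrite sqr_enormD -/e.
have H3 : A * h * 2 <= 2 * c * h * e ^+ 2 + 2 * c * (1 + M) * (h ^+ 2 + h * e ^+ 2).
  (* absorb the mixed term by 2 e <= 1 + e^2, and one factor h by h <= 1 *)
  have H4 : 2 * (h * h * e) <= h ^+ 2 + h * e ^+ 2.
    have : h * h * e ^+ 2 <= h * e ^+ 2.
      by rewrite ler_wpM2r ?sqr_ge0// ler_piMl.
    have : 0 <= h * h * (1 - e) ^+ 2.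
      by apply: mulr_ge0; [exact: mulr_ge0|exact: sqr_ge0].
    lra.
  have := ler_wpM2l (_ : 0 <= 2 * c * (1 + M)) H4.
  rewrite !mulr_ge0 ?addr_ge0// => /(_ isT).
  rewrite /A; lra.
have H5 : 0 <= 4 * M ^+ 2 * h * e ^+ 2 by rewrite !mulr_ge0// sqr_ge0.
have H6 : 0 <= 2 * c * h ^+ 2 by rewrite !mulr_ge0// sqr_ge0.
rewrite /aiming_constant; lra.
Qed.

Variable g : 'rV[R]_n -> R.

(** The dynamic programming inequality provides controls of player 2 that
    bring phi at time t' arbitrarily close to r; w' is a cluster point of the
    end points, where phi is at most r by lower semicontinuity.  Being only a
    limit of reachable points, w' is known through its distances. *)
Lemma sublevel_viable t0 phi t t' w r a : 0 <= t0 ->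
  value_majorant U V f g t0 phi ->
  t0 <= t -> t <= t' -> t' <= 1 -> U a -> phi t w <= r ->
  exists2 w', phi t' w' <= r & forall x B,
    (forall v, controls V v ->
       enorm (x - trajectory f t w (cst a) v t') <= B) ->
    enorm (x - w') <= B.
Proof.
move=> t00 [lsc dpp _] tt0 tt t1 Ua wr.
have t01 : t0 <= t <= 1 by rewrite tt0 (le_trans tt).
have t'01 : t0 <= t' <= 1 by rewrite (le_trans tt0).
have tt1 : t <= t' <= 1 by rewrite tt.
have tge : 0 <= t := le_trans t00 tt0.
have ca := controls_cst Ua.
have /choice[v Hv] : forall j : nat, exists v, controls V v /\
    phi t' (trajectory f t w (cst a) v t') <= r + 1 / 2 ^+ j.
  move=> j; have j0 : 0 < 1 / 2 ^+ j :> R by rewrite divr_gt0// exprn_gt0.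
  have H : (ereal_inf [set (phi t' (trajectory f t w (cst a) v t'))%:E
      | v in controls V] < (r + 1 / 2 ^+ j)%:E)%E.
    apply: (@le_lt_trans _ _ (phi t w)%:E); last by rewrite lte_fin; lra.
    apply: le_trans (dpp t w t' t01 tt1).
    by apply: ereal_sup_ubound; exists a.
  have [_ [v cv <-]] := ereal_inf_lt H.
  by rewrite lte_fin => /ltW; exists v.
have [j|j|p pr Hp] := @lsc_limit _ _ (phi t')
    (fun j => trajectory f t w (cst a) (v j) t') w (M * (t' - t)) r (lsc _ t'01).
- by apply: (trajectory_dist reg) => //; case: (Hv j).
- by case: (Hv j).
exists p => // x B HB; apply: Hp => j; rewrite (le_trans (HB _ (Hv j).1))//.
by rewrite lerDl divr_ge0// exprn_ge0.
Qed.

End OneStep.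

Section FinePartitions.
Context {R : realType}.
Implicit Types (a d : R) (s : seq R).

Lemma grid_le a s i j : itv_partition a 1 s -> (i <= j <= size s)%N ->
  grid a s i <= grid a s j.
Proof.
move=> ps /andP[]; elim: j => [|j IH]; first by rewrite leqn0 => /eqP ->.
rewrite leq_eqVlt => /predU1P[->//|ij js].
have [_ /ltW jj _] := grid_bounds ps js.
by rewrite (le_trans (IH ij (ltnW js))).
Qed.

Lemma mesh_ge a s i : (i < size s)%N -> grid a s i.+1 - grid a s i <= mesh a s.
Proof.
move=> si; pose F (i : 'I_(size s)) := grid a s i.+1 - grid a s i.
exact: (le_bigmax 0 F (Ordinal si)).
Qed.

Lemma fine_partition d a : 0 < d -> a <= 1 ->
  exists2 s, itv_partition a 1 s & mesh a s <= d.
Proof.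
move=> d0; have [N] : exists N, 1 - a <= N%:R * d.
  exists (Num.bound `|(1 - a) / d|).
  rewrite -ler_pdivrMr// (le_trans (ler_norm _))// ltW//.
  exact: archi_boundP.
elim: N a => [|N IH] a.
  rewrite mul0r subr_le0 => a1 a1'; exists [::].
    by split => //=; rewrite eq_le a1 a1'.
  by rewrite /mesh big_ord0 ltW.
rewrite -natr1 mulrDl mul1r => aN a1.
have [da|ad] := leP (1 - a) d.
  move: a1; rewrite le_eqVlt => /predU1P[->|a1].
    by exists [::] => //; rewrite /mesh big_ord0 ltW.
  exists [:: 1]; first exact: itv_partition1.
  by rewrite /mesh; apply: bigmax_le => [|[[|//] i1] _]; first exact: ltW.
have [||s ps ms] := IH (a + d); [lra|lra|].
exists (a + d :: s).
  by case: ps => ps ls; split => //=; rewrite ltrDl d0.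
rewrite /mesh; apply: bigmax_le => [|[[|i] iN] _ /=]; first exact: ltW.
  by rewrite /grid/= addrAC subrr add0r.
apply: le_trans ms; rewrite /grid/=.
rewrite (set_nth_default (a + d)) 1?(set_nth_default (a + d) a)//; last exact: ltnW.
exact: mesh_ge.
Qed.

End FinePartitions.

Section ExtremalStrategy.
Context {R : realType} {n k l : nat}.
Variables (U : set 'rV[R]_k) (V : set 'rV[R]_l).
Variable f : R -> 'rV[R]_n -> 'rV[R]_k -> 'rV[R]_l -> 'rV[R]_n.
Variable g : 'rV[R]_n -> R.
Variables (M c K : R).
Hypothesis reg : regular_dynamics U V f M c.
Hypothesis isaacs : forall t x xi, 0 <= t <= 1 ->
  has_value U V (local_payoff f t x xi).
Hypothesis K0 : 0 <= K.
Hypothesis g_lip : forall x y, `|g x - g y| <= K * enorm (x - y).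
Hypotheses (U0 : U !=set0) (V0 : V !=set0).

Lemma closest_selection_exists t0 x0 phi : 0 <= t0 ->
  value_majorant U V f g t0 phi -> exists pi1, closest_selection phi t0 x0 pi1.
Proof.
move=> t00 maj; have [u0 Uu0] := U0.
have /choice[p1 Hp1] : forall tx : R * 'rV[R]_n, exists p, t0 <= tx.1 <= 1 ->
    sublevel phi t0 x0 tx.1 p /\ forall y, sublevel phi t0 x0 tx.1 y ->
      enorm (tx.2 - p) <= enorm (tx.2 - y).
  move=> [t x] /=; have [/andP[tt t1]|nt] := pselect (t0 <= t <= 1); last by exists 0.
  have [w wr _] := sublevel_viable reg t00 maj (lexx t0) tt t1 Uu0 (lexx (phi t0 x0)).
  have [|p pr Hp] := @closest_point _ _ (phi t) (phi t0 x0) x w _ wr.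
    by case: maj => lsc _ _; apply: lsc; rewrite tt.
  by exists p.
by exists (fun t x => p1 (t, x)) => t x; exact: (Hp1 (t, x)).
Qed.

Lemma optimal_selection_exists t0 : 0 <= t0 ->
  exists pi2, optimal_selection U V f t0 pi2.
Proof.
move=> t00.
have /choice[p2 Hp2] : forall q : R * 'rV[R]_n * 'rV[R]_n, exists v,
    t0 <= q.1.1 <= 1 -> optimal_min U V (local_payoff f q.1.1 q.1.2 q.2) v.
  move=> [[t x] xi] /=.
  have [/andP[tt t1]|nt] := pselect (t0 <= t <= 1); last by exists 0.
  have [|_ _ _ [v Vv vE] _] := @isaacs t x xi; first by rewrite (le_trans t00).
  by exists v.
by exists (fun t x xi => p2 (t, x, xi)) => t x xi; exact: (Hp2 (t, x, xi)).
Qed.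

Variables (t0 : R) (x0 : 'rV[R]_n) (s : seq R).
Variable pi1 : R -> 'rV[R]_n -> 'rV[R]_n.
Variable pi2 : R -> 'rV[R]_n -> 'rV[R]_n -> 'rV[R]_l.
Hypothesis t01 : 0 <= t0 <= 1.
Hypothesis ps : itv_partition t0 1 s.
Hypothesis opt : optimal_selection U V f t0 pi2.

Local Notation upto := (extremal_upto f t0 x0 s pi1 pi2).
Local Notation ext := (extremal_strategy f t0 x0 s pi1 pi2).

Let t00 : 0 <= t0. Proof. by case/andP: t01. Qed.

Lemma grid_itv m : (m <= size s)%N -> t0 <= grid t0 s m <= 1.
Proof.
move=> ms; apply/andP; split.
  by have := @grid_le _ t0 s 0 m ps; rewrite ms; apply.
by rewrite -(grid_last ps); apply: grid_le => //; rewrite ms leqnn.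
Qed.

Let grid01 m : (m <= size s)%N -> 0 <= grid t0 s m <= 1.
Proof. by move=> /grid_itv/andP[tm ->]; rewrite (le_trans t00 tm). Qed.

Lemma feedback_in t x : t0 <= t <= 1 -> V (feedback pi1 pi2 t x).
Proof. by move=> tt; have [] := opt x (x - pi1 t x) tt. Qed.

Lemma extremal_upto_controls u m : (m <= size s)%N -> controls V (upto u m).
Proof.
elim: m => [|m IH] ms.
  by apply: controls_cst; apply: feedback_in; case/andP: t01 => _ ->; rewrite lexx.
apply: controls_glue; first exact: IH (ltnW ms).
by apply: controls_cst; apply: feedback_in; apply: grid_itv; exact: ltnW.
Qed.

Lemma extremal_upto_prefix u m m' r : (m <= m' <= size s)%N ->
  r < grid t0 s m -> upto u m' r = upto u m r.
Proof.
move=> /andP[]; elim: m' => [|m' IH]; first by rewrite leqn0 => /eqP ->.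
rewrite leq_eqVlt => /predU1P[->//|mm' ms] rm /=.
rewrite (lt_le_trans rm) ?IH// 1?ltnW//.
by apply: grid_le => //; rewrite -ltnS mm' ltnW.
Qed.

(** The position at the m-th grid point, hence the action chosen there, depends
    only on the control of player 1 up to that point. *)
Lemma extremal_upto_delay u1 u2 m : (m < size s)%N ->
  controls U u1 -> controls U u2 ->
  eq_ae_on t0 (grid t0 s m) u1 u2 -> upto u1 m.+1 = upto u2 m.+1.
Proof.
move=> ms c1 c2 uu.
suff H j : (j <= m.+1)%N -> upto u1 j = upto u2 j by exact: H.
elim: j => [//|j IH jm]; have {}IH := IH (ltnW jm).
have js : (j < size s)%N by apply: leq_trans ms.
rewrite /= IH.
rewrite (_ : trajectory f t0 x0 u1 _ _ =
  trajectory f t0 x0 u2 (upto u2 j) (grid t0 s j))//.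
have /andP[tj j1] := grid_itv (ltnW js).
have cv := extremal_upto_controls u2 (ltnW js).
apply: (trajectory_ae reg) => //; last exact: eq_ae_on_refl.
apply: eq_ae_onS (lexx _) _ uu; apply: grid_le => //.
by rewrite -ltnS jm ltnW.
Qed.

Lemma extremal_strategyP : strategies2 U V t0 ext.
Proof.
split; first by move=> u _; exact: extremal_upto_controls.
exists s => // u1 u2 m c1 c2 ms uu.
apply: eq_on_eq_ae_on => r /andP[_ rm].
rewrite /extremal_strategy !(@extremal_upto_prefix _ m.+1 (size s)) ?ms ?leqnn//.
by rewrite (extremal_upto_delay ms c1 c2 uu).
Qed.

Variable phi : R -> 'rV[R]_n -> R.
Hypothesis maj : value_majorant U V f g t0 phi.
Hypothesis close : closest_selection phi t0 x0 pi1.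

Local Notation C := (aiming_constant M c).
Let position u m := trajectory f t0 x0 u (upto u m) (grid t0 s m).

(** On each step of length h player 2 plays the action of the saddle point in
    the direction from the closest point of the sublevel set; viability moves
    that point along a competing trajectory driven by the other half of the
    saddle point.  The squared distances thus satisfy
    d' <= (1 + C h) d + C h^2, and h <= mesh gives the closed form. *)
Lemma extremal_distance u m : controls U u -> (m <= size s)%N ->
  enorm (position u m - pi1 (grid t0 s m) (position u m)) ^+ 2 <=
  mesh t0 s * (expR (C * (grid t0 s m - t0)) - 1).
Proof.
move=> cu; elim: m => [_|m IH ms].
  rewrite /position /= /grid/= subrr mulr0 expR0 subrr mulr0.
  have [_ H] := @close t0 (trajectory f t0 x0 u (upto u 0) t0)
    ltac:(by case/andP: t01 => _ ->; rewrite lexx).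
  have := H x0 (lexx _); rewrite (trajectory_start reg x0 t01 cu); last first.
    exact: (@extremal_upto_controls u 0).
  rewrite subrr enorm0 => d0.
  rewrite (_ : enorm _ = 0) ?expr0n//.
  by apply/eqP; rewrite eq_le d0 enorm_ge0.
have [tm mm m1] := grid_bounds ps ms; have ms' := ltnW ms.
have {}IH := IH ms'.
set tm0 := grid t0 s m in tm mm IH *; set tm1 := grid t0 s m.+1 in mm m1 *.
pose xm := position u m; pose w := pi1 tm0 xm.
pose b := feedback pi1 pi2 tm0 xm.
have tm01 : t0 <= tm0 <= 1 := grid_itv ms'.
have tm001 : 0 <= tm0 <= 1 := grid01 ms'.
have Vb : V b := feedback_in xm tm01.
have cv := extremal_upto_controls u ms; have cv' := extremal_upto_controls u ms'.
have [a Ua saddle] := saddle_inequality (isaacs xm (xm - w) tm001)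
  (opt xm (xm - w) tm01).
have [ww _] := close xm tm01.
have tm1_01 : t0 <= tm1 <= 1 := grid_itv ms.
have [w' w'r Hw'] := sublevel_viable reg t00 maj tm (ltW mm) m1 Ua ww.
have Xm : trajectory f t0 x0 u (upto u m.+1) tm0 = xm.
  have /andP[? ?] := tm01.
  apply: (trajectory_ae reg) => //; first exact: eq_ae_on_refl.
  by apply: eq_on_eq_ae_on => r /andP[_ rm] /=; rewrite rm.
have sX : solution f tm0 tm1 u (cst b) (trajectory f t0 x0 u (upto u m.+1)).
  have [_ /(solutionS tm m1)] := trajectoryP reg x0 t01 cu cv.
  apply: solution_ae; first exact: eq_ae_on_refl.
  apply: eq_on_eq_ae_on => r /andP[rm _] /=.
  by rewrite ltNge rm.
pose h := tm1 - tm0; pose e := enorm (xm - w).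
have C0 : 0 <= C := aiming_constant_ge0 reg.
have h0 : 0 <= h by rewrite subr_ge0 ltW.
have Bge0 : 0 <= (1 + C * h) * e ^+ 2 + C * h ^+ 2.
  have C1 : 0 <= 1 + C * h by apply: addr_ge0 => //; exact: mulr_ge0.
  by apply: addr_ge0; apply: mulr_ge0 => //; exact: sqr_ge0.
have [_ Hclose] := close (position u m.+1) tm1_01.
have d1 : enorm (position u m.+1 - pi1 tm1 (position u m.+1)) ^+ 2 <=
    (1 + C * h) * e ^+ 2 + C * h ^+ 2.
  rewrite -[leRHS]sqr_sqrtr// ler_pXn2r// ?nnegrE ?enorm_ge0 ?sqrtr_ge0//.
  apply: le_trans (Hclose w' w'r) _; apply: Hw' => v cv0.
  rewrite -[leLHS]ger0_norm ?enorm_ge0// -sqrtr_sqr ler_wsqrtr//.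
  have [W0 sW] := trajectoryP reg w tm001 (controls_cst Ua) cv0.
  have := solutionS (lexx _) m1 sW => {}sW.
  have tm00 : 0 <= tm0 by case/andP: tm001.
  exact: (aiming_step reg tm00 (ltW mm) m1 cu cv0 Ua Vb saddle sX Xm sW W0).
apply: (le_trans d1); rewrite /position -/tm0 -/xm -/w -/e in IH.
set E := expR (C * (tm0 - t0)) in IH.
have -> : expR (C * (tm1 - t0)) = E * expR (C * h).
  by rewrite /E -expRD; congr expR; rewrite /h; ring.
have hm : h <= mesh t0 s := mesh_ge t0 ms.
have mesh0 : 0 <= mesh t0 s := le_trans h0 hm.
have E0 : 0 <= E := expR_ge0 _.
have Ch0 : 0 <= C * h by rewrite mulr_ge0.
apply: (@le_trans _ _ ((1 + C * h) * (mesh t0 s * (E - 1)) + C * h * mesh t0 s)).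
  apply: lerD; first by apply: ler_wpM2l IH; rewrite addr_ge0.
  by rewrite expr2 mulrA ler_wpM2l.
have : mesh t0 s * E * (1 + C * h) <= mesh t0 s * E * expR (C * h).
  by rewrite ler_wpM2l ?expR_ge1Dx// mulr_ge0.
lra.
Qed.

Lemma extremal_payoff u : controls U u ->
  payoff f g t0 x0 u (ext u) <=
  phi t0 x0 + K * Num.sqrt (mesh t0 s * (expR C - 1)).
Proof.
move=> cu; have := extremal_distance cu (leqnn _).
rewrite /position (grid_last ps) -/(ext u).
set x := trajectory f t0 x0 u (ext u) 1 => dx.
have t1 : t0 <= 1 by case/andP: t01.
have [wr _] := @close 1 x ltac:(by rewrite lexx t1).
have := le_trans (majorant_terminal maj (pi1 1 x)) wr.
rewrite /payoff -/x.
have : enorm (x - pi1 1 x) <= Num.sqrt (mesh t0 s * (expR C - 1)).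
  rewrite -[leLHS]ger0_norm ?enorm_ge0// -sqrtr_sqr ler_wsqrtr//.
  apply: le_trans dx _; rewrite ler_wpM2l//.
    by rewrite /mesh bigmax_idl le_max lexx.
  rewrite lerD2r ler_expR -[leRHS]mulr1 ler_wpM2l//.
    exact: aiming_constant_ge0 reg.
  by move: t00; lra.
move=> /(ler_wpM2l K0) H1 H2.
have := g_lip x (pi1 1 x); rewrite ler_norml => /andP[_ H3].
lra.
Qed.

Lemma extremal_outcome a : strategies1 U V t0 a ->
  outcome U V f g t0 x0 a ext <=
  phi t0 x0 + K * Num.sqrt (mesh t0 s * (expR C - 1)).
Proof.
move=> sa.
have [u cu ->] := outcome_payoff2 U0 V0 g reg x0 t01 sa extremal_strategyP.
exact: extremal_payoff.
Qed.

End ExtremalStrategy.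

(** * The lower value is a value majorant *)

Section LowerValue.
Context {R : realType} {n k l : nat}.
Variables (U : set 'rV[R]_k) (V : set 'rV[R]_l).
Variable f : R -> 'rV[R]_n -> 'rV[R]_k -> 'rV[R]_l -> 'rV[R]_n.
Variable g : 'rV[R]_n -> R.
Variables (M c K : R).
Hypothesis reg : regular_dynamics U V f M c.
Hypothesis K0 : 0 <= K.
Hypothesis g_lip : forall x y, `|g x - g y| <= K * enorm (x - y).
Hypotheses (U0 : U !=set0) (V0 : V !=set0).

Local Notation val := (value U V f g).
Local Notation L := (K * stability_constant c).

Let glip2 : exists2 K : R, 0 <= K &
  forall x y, `|g x - g y| <= K * enorm (x - y).
Proof. by exists K. Qed.

Let L0 : 0 <= L.
Proof. by rewrite mulr_ge0// stability_constant_ge0. Qed.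

Lemma payoff_lipschitz t x y u v : 0 <= t <= 1 -> controls U u ->
  controls V v ->
  payoff f g t x u v <= payoff f g t y u v + L * enorm (x - y).
Proof.
move=> /andP[t0 t1] cu cv; rewrite -lerBlDl.
rewrite (le_trans (ler_norm _))// (le_trans (g_lip _ _))// -mulrA ler_wpM2l//.
exact: (trajectory_stable reg).
Qed.

(** The same strategy of player 1 is used from both positions. *)
Lemma value_lipschitz t x y : 0 <= t <= 1 ->
  val t x <= val t y + L * enorm (x - y).
Proof.
move=> t01; apply/ler_addgt0Pl => e e0.
have [a sa Ha] := value_approx U0 V0 reg glip2 x t01 e0.
suff : val t x - e - L * enorm (x - y) <= val t y by lra.
apply: (value_ge U0 V0 reg glip2 t01 sa) => v cv.
have := Ha v cv; have := payoff_lipschitz x y t01 (sa.1 _ cv) cv; lra.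
Qed.

Lemma value_terminal x : val 1 x = g x.
Proof.
have t01 : 0 <= (1 : R) <= 1 by rewrite ler01 lexx.
have pE u v : controls U u -> controls V v -> payoff f g 1 x u v = g x.
  by move=> cu cv; rewrite /payoff (trajectory_start reg).
have [u0 Uu0] := U0; have [v0 Vv0] := V0.
apply/eqP; rewrite eq_le; apply/andP; split.
- apply/ler_addgt0Pl => e e0.
  have [a sa Ha] := value_approx U0 V0 reg glip2 x t01 e0.
  have := Ha _ (controls_cst Vv0).
  rewrite pE ?lerBlDr// 1?addrC//.
    exact: (sa.1 _ (controls_cst Vv0)).
  exact: controls_cst.
- have s0 : strategies1 U V 1 (cst (cst u0)).
    by apply: cst_strategy => //; exact: controls_cst.
  by apply: (value_ge U0 V0 reg glip2 t01 s0) => v cv; rewrite pE//; exact: controls_cst.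
Qed.

(** The payoff and the value are Lipschitz in the position, so that strategies
    nearly optimal at the points of a finite net serve the whole ball; being
    finitely many, they share a partition P. *)
Lemma strategy_net t x (r e : R) : 0 <= t <= 1 -> 0 <= r -> 0 < e ->
  exists P, exists2 alpha : 'rV[R]_n -> (R -> 'rV[R]_l) -> (R -> 'rV[R]_k),
    forall y, strategies1 U V t (alpha y) &
    forall y, enorm (y - x) <= r -> delayed V t P (alpha y) /\
      forall v, controls V v -> val t y - e <= payoff f g t y (alpha y v) v.
Proof.
move=> t01 r0 e0.
have e3 : 0 < e / 3 by rewrite divr_gt0.
have /choice[aP HaP] : forall y, exists aP : ((R -> 'rV[R]_l) -> (R -> 'rV[R]_k)) * seq R,
    [/\ strategies1 U V t aP.1, delayed V t aP.2 aP.1 &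
      forall v, controls V v -> val t y - e / 3 <= payoff f g t y (aP.1 v) v].
  move=> y; have [a sa Ha] := value_approx U0 V0 reg glip2 y t01 e3.
  by have [P dP] := strategy_delayed sa; exists (a, P).
(* at distance d the error in the payoff is at most e / 3; it is made once in
   the payoff and once in the value, on top of the e / 3 of suboptimality *)
pose d := e / 3 / (L * n.+1%:R + 1).
have den0 : 0 < L * n.+1%:R + 1 by rewrite ltr_wpDl// mulr_ge0.
have d0 : 0 < d by rewrite divr_gt0.
have r1 : 0 < r + 1 by rewrite ltr_wpDl.
have cB : compact (closed_ball x (r + 1)).
  apply: bounded_closed_compact; last exact: closed_ball_closed.
  exists (`|x| + (r + 1)); split; first by rewrite num_real.
  move=> q rq y; rewrite closed_ballE// /closed_ball_/= => xy.
  rewrite -(subrK x y) (le_trans (ler_normD _ _))//.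
  by rewrite addrC (le_trans _ (ltW rq))// lerD2l distrC.
move: cB; rewrite compact_cover => /(_ _ setT (fun y => ball y d)).
case=> [y _|y _|D _ cover].
- exact: ball_open.
- by exists y => //; exact: ballxx.
have /choice[sel Hsel] : forall y, exists z, enorm (y - x) <= r ->
    z \in D /\ L * enorm (y - z) <= e / 3.
  move=> y; have [yr|nyr] := pselect (enorm (y - x) <= r); last by exists 0.
  have [|z /= zD] := cover y.
    rewrite closed_ballE// /closed_ball_/= distrC.
    by rewrite (le_trans (mx_norm_le_enorm _))// (le_trans yr)// lerDl.
  rewrite -ball_normE/= distrC => yz; exists z => _; split => //.
  rewrite (le_trans (ler_wpM2l L0 (enorm_le_mx_norm _)))// mulrA.
  rewrite (@le_trans _ _ ((L * n.+1%:R + 1) * d))//.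
    by apply: ler_pM; rewrite ?mulr_ge0// ?lerDl// ltW.
  by rewrite /d mulrC divfK// gt_eqF.
exists (flatten [seq (aP z).2 | z <- enum_fset D]).
exists (fun y => (aP (sel y)).1) => y; first by have [] := HaP (sel y).
move=> yr; have [_ dP Ha] := HaP (sel y); have [yD yz] := Hsel y yr; split.
  apply: delayedS dP => p pP; apply/flattenP.
  by exists (aP (sel y)).2 => //; apply/mapP; exists (sel y).
move=> v cv; have := Ha v cv; have [sa _ _] := HaP (sel y).
have := payoff_lipschitz (sel y) y t01 (sa.1 _ cv) cv.
have := value_lipschitz y (sel y) t01.
rewrite (enormB (sel y)); lra.
Qed.

(** The dynamic programming inequality.  Player 1 uses the action a up to t',
    then a nearly optimal strategy of a finite net for the position reached
    at t'. *)
Lemma value_superoptimal t t' x a I : 0 <= t -> t <= t' -> t' <= 1 -> U a ->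
  (forall v, controls V v -> I <= val t' (trajectory f t x (cst a) v t')) ->
  I <= val t x.
Proof.
move=> t0 tt t1 Ua HI; apply/ler_addgt0Pl => e e0.
have t01 : 0 <= t <= 1 by rewrite t0 (le_trans tt).
have t'01 : 0 <= t' <= 1 by rewrite (le_trans t0).
have M0 : 0 <= M by case: reg.
have [P [alpha salpha Halpha]] := strategy_net x t'01 M0 e0.
have ca := controls_cst Ua.
pose pos v := trajectory f t x (cst a) v t'.
pose b v s := if s < t' then a else alpha (pos v) v s.
have posM v : controls V v -> enorm (pos v - x) <= M.
  move=> cv; rewrite (le_trans (trajectory_dist reg x t0 tt t1 ca cv))//.
  by rewrite -[leRHS]mulr1 ler_wpM2l//; lra.
have cb v : controls V v -> controls U (b v).
  by move=> cv; apply: (controls_glue (u := cst a)) => //; exact: (salpha (pos v)).1.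
have sb : strategies1 U V t b.
  apply: (@delayed_strategy _ _ _ _ _ _ (t' :: P)) => //; first by case/andP: t01.
  move=> r r' v1 v2 tr rr r1 av c1 c2 vv.
  have [r't|t'r'] := leP r' t'.
    apply: eq_on_eq_ae_on => s /andP[_ sr'].
    by rewrite /b (lt_le_trans sr' r't).
  have t'r : t' <= r.
    have := av t'; rewrite inE eqxx => /(_ isT).
    by rewrite t'r' andbT -leNgt.
  have pE : pos v1 = pos v2.
    apply: (trajectory_ae reg) => //; first exact: eq_ae_on_refl.
    exact: eq_ae_onS (lexx _) t'r vv.
  have [dP _] := Halpha _ (posM v2 c2).
  have : eq_ae_on t' r' (alpha (pos v2) v1) (alpha (pos v2) v2).
    apply: (dP r r') => //; last exact: eq_ae_onS tt (lexx _) vv.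
    by move=> p pP; apply: av; rewrite inE pP orbT.
  apply: aeS => s + sab; rewrite /b pE; case: ltP => // t's; apply.
  by move: sab; rewrite /= !in_itv/= t's => /andP[].
suff : I - e <= val t x by lra.
apply: (value_ge U0 V0 reg glip2 t01 sb) => v cv.
have [_ Hv] := Halpha _ (posM v cv).
have := Hv v cv; have := HI v cv; rewrite -/(pos v).
suff -> : payoff f g t x (b v) v = payoff f g t' (pos v) (alpha (pos v) v) v by lra.
rewrite /payoff -(trajectory_flow reg x t0 tt t1 (lexx _) (cb v cv) cv).
have -> : trajectory f t x (b v) v t' = pos v.
  apply: (trajectory_ae reg) => //; [exact: cb| |exact: eq_ae_on_refl].
  by apply: eq_on_eq_ae_on => s /andP[_ st]; rewrite /b st.
congr g; have [? ?] := andP t'01.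
apply: (trajectory_ae reg) => //; [exact: cb|exact: (salpha _).1| |exact: eq_ae_on_refl].
by apply: eq_on_eq_ae_on => s /andP[t's _]; rewrite /b ltNge t's.
Qed.

Lemma value_is_majorant t0 : 0 <= t0 -> value_majorant U V f g t0 val.
Proof.
move=> t00; split.
- move=> t /andP[tt t1] x r; rewrite lte_fin => rx.
  have t01 : 0 <= t <= 1 by rewrite (le_trans t00).
  have den0 : 0 < L * n.+1%:R + 1 by rewrite ltr_wpDl// mulr_ge0.
  have d0 : 0 < (val t x - r) / (L * n.+1%:R + 1) by rewrite divr_gt0// subr_gt0.
  exists (ball x ((val t x - r) / (L * n.+1%:R + 1))); first exact: nbhsx_ballx.
  move=> y; rewrite -ball_normE/= ltr_pdivlMr// => xy; rewrite lte_fin.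
  have := value_lipschitz x y t01.
  have := ler_wpM2l L0 (enorm_le_mx_norm (x - y)).
  have := normr_ge0 (x - y); move: xy; move: (`|x - y|) => z.
  rewrite mulrDr mulr1 => H1 H2 H3 H4.
  have : L * (n.+1%:R * z) = z * (L * n.+1%:R) by ring.
  lra.
- move=> t x t' /andP[tt t1] /andP[tt' t'1].
  apply: ge_ereal_sup => _ [a Ua <-].
  set I := ereal_inf _.
  have Ile v : controls V v -> (I <= (val t' (trajectory f t x (cst a) v t'))%:E)%E.
    by move=> cv; apply: ereal_inf_lbound; exists v.
  have [v0 Vv0] := V0.
  case: I Ile => [r| |] Ile; last exact: leNye.
    rewrite lee_fin; apply: (@value_superoptimal t t' x a) => //.
    exact: le_trans tt.
  by have := Ile _ (controls_cst Vv0); rewrite leye_eq.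
- by move=> x; rewrite value_terminal.
Qed.

End LowerValue.

(** * The value and its characterization *)

Lemma small_aiming_error (R : realType) (K E eps : R) : 0 <= K -> 0 <= E ->
  0 < eps -> exists2 d, 0 < d & forall h, h <= d -> K * Num.sqrt (h * E) <= eps.
Proof.
move=> K0 E0 eps0.
have K1 : 0 < K + 1 by rewrite ltr_wpDl.
have E1 : 0 < E + 1 by rewrite ltr_wpDl.
have q0 : 0 < eps / (K + 1) by rewrite divr_gt0.
exists ((eps / (K + 1)) ^+ 2 / (E + 1)); first by rewrite divr_gt0// exprn_gt0.
move=> h hd; apply: (@le_trans _ _ (K * (eps / (K + 1)))).
  rewrite ler_wpM2l// -[leRHS](ger0_norm (ltW q0)) -sqrtr_sqr ler_wsqrtr//.
  apply: le_trans (ler_wpM2r E0 hd) _.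
  by rewrite mulrAC ler_pdivrMr// ler_wpM2l ?sqr_ge0// lerDl.
by rewrite mulrCA ler_piMr ?(ltW eps0)// ler_pdivrMr// mul1r lerDl.
Qed.

Theorem theorem2p4 (R : realType) (n k l : nat)
  (U : set 'rV[R]_k) (V : set 'rV[R]_l)
  (f : R -> 'rV[R]_n -> 'rV[R]_k -> 'rV[R]_l -> 'rV[R]_n)
  (g : 'rV[R]_n -> R)
  (U_compact : compact U) (U_nonempty : U !=set0)
  (V_compact : compact V) (V_nonempty : V !=set0)
  (f_standing : standing_assumptions U V f)
  (g_lipschitz : exists K : R, forall x y, `|g x - g y| <= K * enorm (x - y))
  (t0 : R) (x0 : 'rV[R]_n) (t0_01 : 0 <= t0 <= 1) :
  [/\ lower_value U V f g t0 x0 = (value U V f g t0 x0)%:E,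
      upper_value U V f g t0 x0 = (value U V f g t0 x0)%:E,
      ereal_inf [set (phi t0 x0)%:E | phi in value_majorant U V f g t0] =
        (value U V f g t0 x0)%:E
    & t0 < 1 ->
      forall eps : R, 0 < eps -> exists2 delta : R, 0 < delta &
        forall (s : seq R)
          (pi1 : R -> 'rV[R]_n -> 'rV[R]_n)
          (pi2 : R -> 'rV[R]_n -> 'rV[R]_n -> 'rV[R]_l),
        itv_partition t0 1 s -> mesh t0 s <= delta ->
        closest_selection (value U V f g) t0 x0 pi1 ->
        optimal_selection U V f t0 pi2 ->
        (ereal_sup
           [set (outcome U V f g t0 x0 a
                   (extremal_strategy f t0 x0 s pi1 pi2))%:E
           | a in strategies1 U V t0]
         <= (value U V f g t0 x0 + eps)%:E)%E].
Proof.
have [M [c reg]] := standing_regular f_standing.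
have isaacs := f_isaacs f_standing.
have [K gK] := g_lipschitz.
have K0 : 0 <= `|K| by [].
have g_lip x y : `|g x - g y| <= `|K| * enorm (x - y).
  by rewrite (le_trans (gK x y))// ler_wpM2r ?enorm_ge0 ?ler_norm.
have glip2 : exists2 K : R, 0 <= K &
    forall x y, `|g x - g y| <= K * enorm (x - y) by exists `|K|.
have /andP[t00 t1] := t0_01.
have maj := value_is_majorant reg K0 g_lip U_nonempty V_nonempty t00.
have lowerE := lower_value_fin U_nonempty V_nonempty reg glip2 x0 t0_01.
have E0 : 0 <= expR (aiming_constant M c) - 1.
  by rewrite subr_ge0 -expR0 ler_expR (aiming_constant_ge0 reg).
have asymptotic phi eps : value_majorant U V f g t0 phi -> 0 < eps ->
    exists2 d : R, 0 < d & forall s pi1 pi2, itv_partition t0 1 s ->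
      mesh t0 s <= d -> closest_selection phi t0 x0 pi1 ->
      optimal_selection U V f t0 pi2 ->
      (ereal_sup [set (outcome U V f g t0 x0 a
                   (extremal_strategy f t0 x0 s pi1 pi2))%:E
           | a in strategies1 U V t0] <= (phi t0 x0 + eps)%:E)%E.
  move=> majphi eps0; have [d d0 Hd] := small_aiming_error K0 E0 eps0.
  exists d => // s pi1 pi2 ps ms close opt.
  apply: ge_ereal_sup => _ [a sa <-]; rewrite lee_fin.
  have := extremal_outcome reg isaacs K0 g_lip U_nonempty V_nonempty
    t0_01 ps opt majphi close sa.
  by move=> /le_trans; apply; rewrite lerD2l Hd.
have upper_le phi : value_majorant U V f g t0 phi ->
    (upper_value U V f g t0 x0 <= (phi t0 x0)%:E)%E.
  move=> majphi; apply/lee_addgt0Pr => eps eps0; rewrite -EFinD.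
  have [d d0 Hd] := asymptotic phi eps majphi eps0.
  have [s ps ms] := fine_partition d0 t1.
  have [pi1 close] := closest_selection_exists reg U_nonempty x0 t00 majphi.
  have [pi2 opt] := optimal_selection_exists isaacs t00.
  apply: le_trans (Hd s pi1 pi2 ps ms close opt).
  apply: ereal_inf_lbound; exists (extremal_strategy f t0 x0 s pi1 pi2) => //.
  exact: (extremal_strategyP reg).
have lower_upper := lower_le_upper U V f g t0 x0.
split => //.
- by apply/eqP; rewrite eq_le upper_le//= -lowerE.
- apply/eqP; rewrite eq_le; apply/andP; split.
    by apply: ereal_inf_lbound; exists (value U V f g).
  apply: le_ereal_inf_tmp => _ [phi majphi <-].
  by rewrite -lowerE (le_trans lower_upper)// upper_le.
- by move=> _ eps eps0; exact: asymptotic.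
Qed.
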